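(* Suppose that Assumptions A and B (stated in the context) hold. Let $\{x_k\}$ be generated by Algorithm 1 (stated in the context) with the parameters chosen as $$\rho_k=(k+4)^{3/2},\qquad \beta_k=\frac{k+4}{5},\qquad \gamma_k=\frac{k+4}{10(L_{\nabla f}+\rho_kL_{\nabla c^2})}.$$ Let $$C_1=25D_{\mathcal X}^2+\frac{10\Lambda^2}{L_{\nabla c^2}},\qquad C_2=\frac{20GD_{\mathcal X}L_{\nabla f}}{\sqrt6\,L_{\nabla c^2}}+120GD_{\mathcal X}.$$ Then for all $k\ge 2$, \begin{align*} \|[c(x_k)]_+\|&\le (2C_2)^{1/2}k^{-3/4}+2(C_1L_{\nabla c^2})^{1/2}k^{-1}+2\Lambda k^{-3/2}+2(C_1L_{\nabla f})^{1/2}k^{-7/4},\\ \mathbb E[F(x_k)-F^*]&\le 3\sqrt3\,\sigma^2L_{\nabla c^2}^{-1}k^{-1/2}\log k+2\sqrt3\,C_1L_{\nabla c^2}k^{-1/2}+3\sigma^2L_{\nabla f}L_{\nabla c^2}^{-2}k^{-2}\log k+2C_1L_{\nabla f}k^{-2},\\ \mathbb E[F(x_k)-F^*]&\ge-\Lambda\Big(\sqrt6\,\sigma L_{\nabla c^2}^{-1/2}k^{-1}(\log k)^{1/2}+2(C_1L_{\nabla c^2})^{1/2}k^{-1}+2\Lambda k^{-3/2}\\ &\qquad\quad+\sigma L_{\nabla c^2}^{-1}(6L_{\nabla f})^{1/2}k^{-7/4}(\log k)^{1/2}+2(C_1L_{\nabla f})^{1/2}k^{-7/4}\Big). \end{a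lign*}
   Context: Notation. $\|\cdot\|$ is the Euclidean norm, $\langle\cdot,\cdot\rangle$ the standard inner product, $[\cdot]_+$ the projection onto the nonnegative orthant, $\log$ the natural logarithm. $\nabla\phi$ denotes the transpose of the Jacobian of $\phi$. A mapping $\phi$ is $L_\phi$-Lipschitz continuous on $\Omega$ if $\|\phi(x)-\phi(x')\|\le L_\phi\|x-x'\|$ for all $x,x'\in\Omega$, and $L_{\nabla\phi}$-smooth on $\Omega$ if $\|\nabla\phi(x)-\nabla\phi(x')\|\le L_{\nabla\phi}\|x-x'\|$ for all $x,x'\in\Omega$. $\mathrm{prox}_{\gamma\psi}(v)=\arg\min_x\{\gamma\psi(x)+\tfrac12\|x-v\|^2\}$. Problem. $F^*=\min_x\{F(x):=\mathbb E[\tilde f(x,\xi)]+\psi(x)\}$ subject to $c(x)\le 0$, where $\xi$ is a random variable with (infinite) sample space $\Xi$, $\tilde f(\cdot,\xi)$ is a continuously differentiable convex function on $\mathbb R^n$ for each $\xi\in\Xi$, $\psi:\mathbb R^n\to\mathbb R\cup\{+\infty\}$ is proper closed convex with domain $\mathcal X$, and $c=(c_1,\dots,c_m)$ is a deterministic smooth mapping with each $c_i$ convex. Put $f(x)=\mathbb E[\tilde f(x,\xi)]$. Assumption A. (i) $\mathcal X$ is bounded and there exist $D_{\mathcal X}>0$, $D_F>0$ with $\max_{x,y\in\mathcal X}\|x-y\|\le D_{\mathcal X}$ and $\max_{x\in\mathcal X}F(x)-\min_{x\in\mathcal X}F(x)\le D_F$. (ii) Each $c_i$ is $L_{c_i}$-Lipschitz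 continuous and $L_{\nabla c_i}$-smooth on $\mathcal X$, and $|c_i(x)|\le C_i$ for all $x\in\mathcal X$, $i=1,\dots,m$ (these bounds $C_i$ are distinct from the constants $C_1,C_2$ of the claim). (iii) The set $\boldsymbol{\Lambda}^*$ of optimal Lagrange multipliers of the problem (i.e. of $\lambda\ge0$ with $F^*=\min_x\{F(x)+\langle\lambda,c(x)\rangle\}$) is nonempty; $\Lambda:=\min_{\lambda\in\boldsymbol{\Lambda}^*}\|\lambda\|$. Define $L_{\nabla c^2}:=\sum_{i=1}^m(L_{c_i}^2+C_iL_{\nabla c_i})$ (with the bounds $C_i$ of Assumption A(ii)), taken to be positive. Assumption B. $f$ is $L_{\nabla f}$-smooth on $\mathcal X$, and for constants $\sigma>0$, $G>0$ and all $x\in\mathcal X$: $\mathbb E[\nabla\tilde f(x,\xi)]=\nabla f(x)$, $\mathbb E[\|\nabla\tilde f(x,\xi)-\nabla f(x)\|^2]\le\sigma^2$, $\max_{\xi\in\Xi}\|\nabla\tilde f(x,\xi)\|\le G$. Algorithm 1. Input: $x_1\in\mathcal X$, $\{\beta_k\}\subset[1,\infty)$, $\{\gamma_k\}\subset(0,\infty)$, $\{\rho_k\}\subset(0,\infty)$. Set $z_1=x_1$. For $k=1,2,\dots$: $y_k=(1-\beta_k^{-1})x_k+\beta_k^{-1}z_k$; sample $\xi_k\in\Xi$ (a copy of $\xi$ drawn independently of the previous samples) and set $g_k=\nabla\tilde f(y_k,\xi_k)+\rho_k\nabla c(y_k)[c(y_k)]_+$; $z_{k+1}=\mathrm{prox}_{\gamma_k\psi}(z_k-\gamma_kg_k)$;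 $x_{k+1}=(1-\beta_k^{-1})x_k+\beta_k^{-1}z_{k+1}$. *)

(* Defs.v *)
From HB Require Import structures.
From mathcomp Require Import all_boot all_order all_algebra finmap.
From mathcomp Require Import all_classical all_reals all_analysis.
Set Implicit Arguments.
Unset Strict Implicit.
Unset Printing Implicit Defensive.
Import Order.TTheory GRing.Theory Num.Theory.
Import numFieldNormedType.Exports.

Local Open Scope classical_set_scope.
Local Open Scope ring_scope.

Section euclidean.
Context {R : realType}.

(* The library norm on 'rV[R]_n is the sup norm, hence the definition below;
   both norms give the same topology, so [differentiable] and [continuous]
   are used unchanged. *)
Definition enorm n (v : 'rV[R]_n) : R := Num.sqrt (\sum_i v ord0 i ^+ 2).

Definition edot n (u v : 'rV[R]_n) : R := \sum_i u ord0 i * v ord0 i.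

Definition pospart n (v : 'rV[R]_n) : 'rV[R]_n := \row_i Num.max (v ord0 i) 0.

Definition grad n (phi : 'rV[R]_n -> R) (x : 'rV[R]_n) : 'rV[R]_n :=
  \row_i 'D_(delta_mx ord0 i) phi x.

Definition lipschitz_on n (L : R) (A : set 'rV[R]_n) (phi : 'rV[R]_n -> R) :=
  0 <= L /\
  forall x x', A x -> A x' -> `|phi x - phi x'| <= L * enorm (x - x').

Definition smooth_on n (L : R) (A : set 'rV[R]_n) (phi : 'rV[R]_n -> R) :=
  [/\ 0 <= L,
      forall x, A x -> differentiable phi x &
      forall x x', A x -> A x' ->
        enorm (grad phi x - grad phi x') <= L * enorm (x - x')].

Definition continuously_differentiable n (phi : 'rV[R]_n -> R) :=
  (forall x, differentiable phi x) /\ continuous (grad phi).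

Definition convex_on_space n (phi : 'rV[R]_n -> R) :=
  convex_function (setT : set (convex_lmodType 'rV[R]_n)) phi.

End euclidean.

Section extended_real_functions.
Context {R : realType}.
Local Open Scope ereal_scope.

Definition is_min (S : set (\bar R)) (v : \bar R) := S v /\ lbound S v.

Definition edom n (psi : 'rV[R]_n -> \bar R) : set 'rV[R]_n :=
  [set x | psi x < +oo].

Definition proper n (psi : 'rV[R]_n -> \bar R) :=
  edom psi !=set0 /\ forall x, -oo < psi x.

(* At t = 0 or t = 1 the convention 0 * +oo = 0 makes this trivially true. *)
Definition econvex n (psi : 'rV[R]_n -> \bar R) :=
  forall (x x' : 'rV[R]_n) (t : R), (0 <= t <= 1)%R ->
    psi ((1 - t) *: x + t *: x')%R <= (1 - t)%:E * psi x + t%:E * psi x'.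

(* For a proper closed convex psi and gamma > 0 the minimizer exists and is
   unique, so this relation is the graph of v |-> prox_(gamma psi) v. *)
Definition is_prox n (gamma : R) (psi : 'rV[R]_n -> \bar R)
    (v p : 'rV[R]_n) :=
  forall u, gamma%:E * psi p + (2^-1 * enorm (p - v) ^+ 2)%:E
            <= gamma%:E * psi u + (2^-1 * enorm (u - v) ^+ 2)%:E.

End extended_real_functions.

Section sampling.
Context {R : realType} {d : measure_display} {Omega : measurableType d}
  (P : probability Omega R) {d' : measure_display} {Xi : measurableType d'}.
Local Open Scope ereal_scope.

Definition mutually_independent (I : set nat) (X : nat -> {RV P >-> Xi}) :=
  forall (J : {fset nat}) (A : nat -> set Xi),
    [set` J] `<=` I -> (forall k, measurable (A k)) ->
    P (\bigcap_(k in [set` J]) (X k @^-1` A k))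
    = \prod_(k <- J) P (X k @^-1` A k).

Definition iid_copies (I : set nat) (xi : {RV P >-> Xi})
    (X : nat -> {RV P >-> Xi}) :=
  mutually_independent I X /\
  forall k, I k -> forall A, measurable A ->
    distribution P (X k) A = distribution P xi A.

End sampling.

Section problem.
Context {R : realType} {n m : nat}
  {d : measure_display} {Omega : measurableType d} (P : probability Omega R)
  {d' : measure_display} {Xi : measurableType d'} (xi : {RV P >-> Xi}).
Variables (ftilde : 'rV[R]_n -> Xi -> R) (psi : 'rV[R]_n -> \bar R)
  (c : 'rV[R]_n -> 'rV[R]_m).

Definition fmean (x : 'rV[R]_n) : R := fine 'E_P[ftilde x \o xi]%E.

Definition objective (x : 'rV[R]_n) : \bar R := ((fmean x)%:E + psi x)%E.

Definition component (i : 'I_m) (x : 'rV[R]_n) : R := c x ord0 i.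

Definition gradf (x : 'rV[R]_n) (s : Xi) : 'rV[R]_n := grad (ftilde^~ s) x.

Definition feasible : set 'rV[R]_n := [set x | forall i, component i x <= 0].

Definition is_optimal_value (v : R) := is_min (objective @` feasible) v%:E.

Definition opt_multipliers (v : R) : set 'rV[R]_m :=
  [set lam : 'rV[R]_m | (forall i, 0 <= lam ord0 i) /\
     is_min (range (fun x => (objective x + (edot lam (c x))%:E)%E)) v%:E].

Record convex_stochastic_problem : Prop := {
  csp_infinite : infinite_set [set: Xi];
  csp_measurable : forall x, measurable_fun setT (ftilde x);
  csp_integrable : forall x, P.-integrable setT (EFin \o (ftilde x \o xi));
  csp_f_C1 : forall s, continuously_differentiable (ftilde^~ s);
  csp_f_convex : forall s, convex_on_space (ftilde^~ s);
  csp_psi_proper : proper psi;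
  csp_psi_closed : lower_semicontinuous psi;
  csp_psi_convex : econvex psi;
  csp_c_C1 : forall i, continuously_differentiable (component i);
  csp_c_convex : forall i, convex_on_space (component i) }.

Record assumptionA (Fstar DX DF : R) (Lc Lgc Cb : 'I_m -> R) (Lambda : R)
    : Prop := {
  A_DX_gt0 : 0 < DX;
  A_DF_gt0 : 0 < DF;
  A_diameter : forall x y, edom psi x -> edom psi y -> enorm (x - y) <= DX;
  A_variation : forall x y, edom psi x -> edom psi y ->
    (objective x - objective y <= DF%:E)%E;
  A_c_lipschitz : forall i, lipschitz_on (Lc i) (edom psi) (component i);
  A_c_smooth : forall i, smooth_on (Lgc i) (edom psi) (component i);
  A_c_bounded : forall i x, edom psi x -> `|component i x| <= Cb i;
  A_multiplier : opt_multipliers Fstar !=set0;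
  A_Lambda : is_min [set (enorm lam)%:E | lam in opt_multipliers Fstar]
                    Lambda%:E }.

Record assumptionB (Lgf sigma G : R) : Prop := {
  B_sigma_gt0 : 0 < sigma;
  B_G_gt0 : 0 < G;
  B_f_smooth : smooth_on Lgf (edom psi) fmean;
  B_unbiased : forall x, edom psi x -> forall i,
    ('E_P[fun w => gradf x (xi w) ord0 i] = (grad fmean x ord0 i)%:E)%E;
  B_variance : forall x, edom psi x ->
    ('E_P[fun w => (enorm (gradf x (xi w) - grad fmean x) ^+ 2)%R]
     <= (sigma ^+ 2)%:E)%E;
  B_bounded : forall x s, edom psi x -> enorm (gradf x s) <= G }.

(* The second term is rho * nabla c(y) [c(y)]_+, nabla c(y) being the n x m
   matrix whose i-th column is the gradient of c_i at y. *)
Definition stoch_grad (rho : R) (y : 'rV[R]_n) (s : Xi) : 'rV[R]_n :=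
  gradf y s + rho *: \sum_i pospart (c y) ord0 i *: grad (component i) y.

(* One sample path: s k is the realization of the k-th sample.  Indices start
   at 1; values at index 0 are irrelevant. *)
Record algorithm_run (beta gamma rho : nat -> R) (x1 : 'rV[R]_n)
    (s : nat -> Xi) (x y z : nat -> 'rV[R]_n) : Prop := {
  run_x1_dom : edom psi x1;
  run_x1 : x 1%N = x1;
  run_z1 : z 1%N = x1;
  run_y : forall k, (1 <= k)%N ->
    y k = (1 - (beta k)^-1) *: x k + (beta k)^-1 *: z k;
  run_z : forall k, (1 <= k)%N ->
    is_prox (gamma k) psi
      (z k - gamma k *: stoch_grad (rho k) (y k) (s k)) (z k.+1);
  run_x : forall k, (1 <= k)%N ->
    x k.+1 = (1 - (beta k)^-1) *: x k + (beta k)^-1 *: z k.+1 }.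

End problem.

(* Main.v *)
Require Import Defs.
From HB Require Import structures.
From mathcomp Require Import all_boot all_order all_algebra finmap.
From mathcomp Require Import all_classical all_reals all_analysis.
From mathcomp Require Import measurable_realfun ring lra.
Set Implicit Arguments.
Unset Strict Implicit.
Unset Printing Implicit Defensive.
Import Order.TTheory GRing.Theory Num.Theory.
Import numFieldNormedType.Exports.

Local Open Scope classical_set_scope.
Local Open Scope ring_scope.

(** The algorithm is an accelerated proximal stochastic gradient method applied
    to the penalized objective [F + rho k / 2 * enorm (pospart c) ^+ 2], whose
    smooth part obeys the descent lemma on the domain of [psi] with the constant
    [L k = Lgf + rho k * Lgc2]; the penalty weight [rho k] grows with [k].

    Write [Q k v] for the penalized gap [F v - Fstar + rho k * penalty v], and
    [u] for a solution.  Convexity at the extrapolated point, the descent lemma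
    and the optimality of the proximal point give ([accelerated_step])
    [Q k x_(k+1) <= (1 - 1 / beta k) * Q k x_k
      + L k / beta k ^ 2 * (|z_k - u| ^ 2 - |z_(k+1) - u| ^ 2) + noise].
    After multiplication by [(k + 4) ^ 2 / L k] the squared distances have the
    constant coefficient 25 and telescope.  It remains to pass from [Q k] to
    [Q (k + 1)] at the same point.  There weak duality helps: a multiplier of
    norm [Lambda] forces [F v - Fstar >= - Lambda * violation v], so that the
    weight lost in the factor [1 - 1 / beta] pays for the growth of [rho], at a
    total cost of at most [10 * Lambda ^ 2 / Lgc2] ([penalty_increase],
    [potential_bound]).  Hence [Q k x_(k+1)] is at most [L k / (k + 4) ^ 2] times
    the sum of [C1] and of the weighted noise terms.

    The noise is estimated twice.  On every sample path it is at most
    [2 * G * DX / beta k], whose weighted sum grows like the square root of [k];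
    this yields the constant [C2].  In expectation, Young's inequality absorbs
    the part of the inner product that involves the new proximal point; the rest
    is linear in the noise and has mean zero because the current sample is
    independent of the current iterates, and what is left are the variances,
    with a sum of order [ln k].  The mean-zero argument is an application of
    Fubini's theorem to the law of the pair formed by the past and the current
    sample ([integral_fresh_sample]); it requires that the iterates be
    measurable functions of the past ([iterates_adapted]), which holds because
    the sampled gradient is a Caratheodory function and the proximal map is
    nonexpansive.

    A bound [W] on [Q k x_(k+1)] bounds the gap from above since the penalty is
    nonnegative.  Together with weak duality it also gives
    [rho / 2 * t ^ 2 - Lambda * t <= W] for the violation [t], hence a bound on
    [t], hence a lower bound [- Lambda * t] on the gap.  In order to take
    expectations the quadratic is replaced with one of its tangents
    ([tangent_bound]), which makes the bound on [t] affine in [W]. *)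

(** * Euclidean geometry and convex functions *)

Section euclidean_space.
Context {R : realType}.

Section vectors.
Context {n : nat}.
Implicit Types u v w : 'rV[R]_n.

Lemma edotC u v : edot u v = edot v u.
Proof. by apply: eq_bigr => i _; rewrite mulrC. Qed.

Lemma edotDl u v w : edot (u + v) w = edot u w + edot v w.
Proof.
by rewrite -big_split; apply: eq_bigr => i _ /=; rewrite mxE mulrDl.
Qed.

Lemma edotZl a u v : edot (a *: u) v = a * edot u v.
Proof. by rewrite /edot mulr_sumr; apply: eq_bigr => i _; rewrite mxE mulrA. Qed.

Lemma edotNl u v : edot (- u) v = - edot u v.
Proof. by rewrite -scaleN1r edotZl mulN1r. Qed.

Lemma edotDr u v w : edot w (u + v) = edot w u + edot w v.
Proof. by rewrite ![edot w _]edotC edotDl. Qed.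

Lemma edotZr a u v : edot v (a *: u) = a * edot v u.
Proof. by rewrite ![edot v _]edotC edotZl. Qed.

Lemma edotNr u v : edot v (- u) = - edot v u.
Proof. by rewrite ![edot v _]edotC edotNl. Qed.

Lemma edot0l v : edot 0 v = 0.
Proof. by rewrite -(scale0r v) edotZl mul0r. Qed.

Lemma edot0r v : edot v 0 = 0.
Proof. by rewrite edotC edot0l. Qed.

Definition edotE := (edotDl, edotDr, edotNl, edotNr, edotZl, edotZr).

Lemma edot_sumr (I : Type) (r : seq I) (F : I -> 'rV[R]_n) u :
  edot u (\sum_(i <- r) F i) = \sum_(i <- r) edot u (F i).
Proof.
by elim: r => [|i r IH]; rewrite ?big_nil ?edot0r// !big_cons edotDr IH.
Qed.

Lemma edot_ge0 u : 0 <= edot u u.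
Proof. by apply: sumr_ge0 => i _; rewrite -expr2 sqr_ge0. Qed.

Lemma enorm_ge0 u : 0 <= enorm u.
Proof. exact: sqrtr_ge0. Qed.

Lemma sqr_enorm u : enorm u ^+ 2 = edot u u.
Proof.
rewrite /enorm sqr_sqrtr; last by apply: sumr_ge0 => i _; rewrite sqr_ge0.
by apply: eq_bigr => i _; rewrite expr2.
Qed.

Lemma enormZ a u : enorm (a *: u) = `|a| * enorm u.
Proof.
apply/eqP; rewrite -(@eqrXn2 _ 2) ?mulr_ge0 ?enorm_ge0 ?normr_ge0//.
by rewrite exprMn !sqr_enorm edotZl edotZr mulrA -expr2 real_normK ?num_real.
Qed.

Lemma enormN u : enorm (- u) = enorm u.
Proof. by rewrite -scaleN1r enormZ normrN normr1 mul1r. Qed.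

Lemma normr_coord_le u i : `|u ord0 i| <= enorm u.
Proof.
rewrite -ler_sqr ?nnegrE ?enorm_ge0 ?normr_ge0//.
rewrite real_normK ?num_real// sqr_enorm /edot (bigD1 i)//= expr2 lerDl.
by apply: sumr_ge0 => j _; rewrite -expr2 sqr_ge0.
Qed.

Lemma enorm_eq0 u : enorm u = 0 -> u = 0.
Proof.
move=> u0; apply/rowP => i; rewrite mxE; apply/eqP.
by rewrite -normr_le0 -u0 normr_coord_le.
Qed.

Lemma edot_le u v : edot u v <= enorm u * enorm v.
Proof.
set a := enorm u; set b := enorm v.
have [a0 b0] : 0 <= a /\ 0 <= b by split; exact: enorm_ge0.
have key : 0 <= a * b * (a * b - edot u v).
  have : 0 <= edot (b *: u - a *: v) (b *: u - a *: v) by exact: edot_ge0.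
  rewrite !edotE (edotC v u) -!sqr_enorm -/a -/b.
  nra.
have [/eqP a0'|an0] := eqVneq a 0.
  by rewrite (enorm_eq0 (eqP a0')) edot0l mulr_ge0.
have [/eqP b0'|bn0] := eqVneq b 0.
  by rewrite (enorm_eq0 (eqP b0')) edot0r mulr_ge0.
have ab0 : 0 < a * b by rewrite mulr_gt0// lt_neqAle eq_sym ?an0 ?bn0.
by rewrite -subr_ge0 -(pmulr_rge0 _ ab0).
Qed.

Lemma normr_edot_le u v : `|edot u v| <= enorm u * enorm v.
Proof.
rewrite ler_norml edot_le andbT -lerN2 opprK -edotNl.
by rewrite (le_trans (edot_le _ _))// enormN.
Qed.

Lemma enormD u v : enorm (u + v) <= enorm u + enorm v.
Proof.
rewrite -ler_sqr ?nnegrE ?addr_ge0 ?enorm_ge0//.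
rewrite sqr_enorm !edotE (edotC v u) sqrrD -!sqr_enorm.
have := edot_le u v; lra.
Qed.

Lemma enorm_le_sum u : enorm u <= \sum_i `|u ord0 i|.
Proof.
rewrite -ler_sqr ?nnegrE ?enorm_ge0 ?sumr_ge0//.
rewrite sqr_enorm expr2 mulr_suml; apply: ler_sum => i _.
rewrite -expr2 -[leLHS]real_normK ?num_real// expr2 ler_wpM2l//.
by rewrite (bigD1 i)//= lerDl sumr_ge0.
Qed.

End vectors.

Section convexity.
Context {n : nat}.
Implicit Types (phi : 'rV[R]_n -> R) (x y v : 'rV[R]_n) (A : set 'rV[R]_n).

Definition convex_region A := forall x y (t : R),
  A x -> A y -> 0 <= t <= 1 -> A ((1 - t) *: x + t *: y).

Lemma edot_gradE phi x v :
  differentiable phi x -> edot (grad phi x) v = 'D_v phi x.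
Proof.
move=> dphi; rewrite deriveE// [in RHS](row_sum_delta v) linear_sum/=.
by apply: eq_bigr => i _; rewrite linearZ/= mxE deriveE// mulrC.
Qed.

Lemma convex_on_spaceE phi x y (t : R) : convex_on_space phi -> 0 <= t <= 1 ->
  phi ((1 - t) *: x + t *: y) <= (1 - t) * phi x + t * phi y.
Proof.
move=> cvx /andP[t0 t1].
have s01 : Itv.spec (@Itv.num_sem R) (Itv.Real `[0%Z, 1%Z]) t.
  by rewrite /= /Itv.num_sem/= num_real in_itv/= t0 t1.
have := cvx (Itv.mk s01) y x (mem_set I) (mem_set I).
by rewrite addrC [leRHS]addrC.
Qed.

(** Stated along a sequence: a limit of a sequence of measurable functions is
    measurable, which is how gradients are shown to be measurable in a
    parameter. *)
Lemma cvg_difference_quotient phi y v : differentiable phi y ->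
  (fun k => k.+1%:R * (phi (k.+1%:R^-1 *: v + y) - phi y)) @ \oo
    --> edot (grad phi y) v.
Proof.
move=> dphi; rewrite edot_gradE//.
have /cvgr_dnbhsP := @diff_derivable _ _ _ phi y v dphi.
move=> /(_ (fun k => k.+1%:R^-1)) /= h.
under eq_fun do rewrite -[X in X * _]invrK.
by apply: h; split => [k|]; [rewrite invr_neq0|exact: cvg_harmonic].
Qed.

(** The difference quotients along [x - y] stay below [phi x - phi y]. *)
Lemma convex_gradient_ineq phi x y :
  convex_on_space phi -> differentiable phi y ->
  phi y + edot (grad phi y) (x - y) <= phi x.
Proof.
move=> cvx dphi; rewrite -lerBrDl.
apply: (cvgr_to_le (cvg_difference_quotient (v := x - y) dphi)).
apply: nearW => k; rewrite mulrC -ler_pdivlMr// [leRHS]mulrC.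
set t : R := k.+1%:R^-1.
have t01 : 0 <= t <= 1 by rewrite invr_ge0 ler0n invf_le1// ler1n.
have := convex_on_spaceE y x cvx t01.
have -> : (1 - t) *: y + t *: x = t *: (x - y) + y.
  by rewrite scalerBl scale1r scalerBr addrC addrA addrAC.
lra.
Qed.

Lemma ler_harmonic_limit (a b C : R) :
  (forall k, a <= b + C * k.+1%:R^-1) -> a <= b.
Proof.
move=> ab; have cvb : (fun k => b + C * k.+1%:R^-1) @ \oo --> b.
  rewrite -[X in _ --> X]addr0 -[X in _ --> _ + X](mulr0 C).
  by apply: cvgD; [exact: cvg_cst|apply: cvgMr; exact: cvg_harmonic].
by apply: (cvgr_to_ge cvb); exact: nearW.
Qed.

(** For a convex function the subgradient inequality between consecutive points
    of the regular subdivision of the segment bounds each increment from above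
    by the slope at the farther point.  For [N] pieces the excesses over the slope
    at [y] sum up to at most the upper Riemann sum of
    [L * t * enorm (x - y) ^+ 2] over [0, 1], which is
    [L / 2 * (1 + 1 / N) * enorm (x - y) ^+ 2]. *)
Lemma descent_lemma (A : set 'rV[R]_n) (g : 'rV[R]_n -> R)
    (Dg : 'rV[R]_n -> 'rV[R]_n) (L : R) x y :
  convex_region A ->
  (forall u v, A u -> A v -> g v + edot (Dg v) (u - v) <= g u) ->
  (forall u v, A u -> A v -> enorm (Dg u - Dg v) <= L * enorm (u - v)) ->
  A x -> A y ->
  g x <= g y + edot (Dg y) (x - y) + L / 2 * enorm (x - y) ^+ 2.
Proof.
move=> cA sub lip Ax Ay.
apply: (@ler_harmonic_limit _ _ (L / 2 * enorm (x - y) ^+ 2)) => N0.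
set v := x - y; set N : R := N0.+1%:R.
have N_gt0 : 0 < N by rewrite ltr0n.
pose p (i : nat) := y + (i%:R / N) *: v.
have Ap i : (i <= N0.+1)%N -> A (p i).
  move=> iN; have -> : p i = (1 - i%:R / N) *: y + (i%:R / N) *: x.
    by rewrite /p scalerBl scale1r scalerBr addrA addrAC.
  by apply: cA => //; rewrite divr_ge0//= ler_pdivrMr// mul1r ler_nat.
suff main i : (i <= N0.+1)%N -> g (p i) <= g y + i%:R / N * edot (Dg y) v
    + L * enorm v ^+ 2 * (i%:R * (i%:R + 1) / (2 * N ^+ 2)).
  have := main _ (leqnn _); rewrite -/N {1}/p -/N divff ?gt_eqF// scale1r.
  rewrite {1}/v addrC subrK mul1r => /le_trans; apply.
  rewrite -subr_ge0.
  rewrite [X in 0 <= X](_ : _ = 0)//; field; rewrite gt_eqF//.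
elim: i => [_|i IH iN].
  by rewrite /p !mul0r scale0r !addr0 mulr0 addr0.
have ppE : p i - p i.+1 = - (N^-1 *: v).
  rewrite /p opprD addrACA subrr add0r -scalerBl -[RHS]scaleNr.
  by congr (_ *: _); rewrite -natr1; field; rewrite gt_eqF.
have pyE : p i.+1 - y = (i.+1%:R / N) *: v by rewrite /p addrC addKr.
have h1 := sub _ _ (Ap i (ltnW iN)) (Ap _ iN).
have h2 := lip _ _ (Ap _ iN) Ay.
have h3 := edot_le (Dg (p i.+1) - Dg y) v.
move: h1 h2; rewrite ppE pyE enormZ edotNr edotZr => h1 h2.
rewrite ger0_norm ?divr_ge0// in h2.
move: h3; rewrite edotDl edotNl => h3.
have h4 : edot (Dg (p i.+1)) v <=
    edot (Dg y) v + L * enorm v ^+ 2 * (i.+1%:R / N).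
  have := ler_wpM2r (enorm_ge0 v) h2; move: h3.
  by move: (i.+1%:R / N) => q; lra.
have h5 : N^-1 * edot (Dg (p i.+1)) v <=
    N^-1 * (edot (Dg y) v + L * enorm v ^+ 2 * (i.+1%:R / N)).
  by rewrite ler_wpM2l// invr_ge0 ltW.
have h6 := IH (ltnW iN).
have h7 : g (p i.+1) <= g y + i%:R / N * edot (Dg y) v
    + L * enorm v ^+ 2 * (i%:R * (i%:R + 1) / (2 * N ^+ 2)) +
    N^-1 * (edot (Dg y) v + L * enorm v ^+ 2 * (i.+1%:R / N)).
  move: h1 h5 h6; move: (N^-1 * edot _ _) (N^-1 * (_ + _)) => b1 b2.
  by move: (g y + _ + _) => b3; lra.
apply: (le_trans h7); rewrite -subr_ge0.
rewrite [X in 0 <= X](_ : _ = 0)//.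
by rewrite -natr1; field; rewrite gt_eqF//.
Qed.

End convexity.
End euclidean_space.

(** * The quadratic penalty, the proximal map and one iteration *)

Section penalty_and_prox.
Context {R : realType} {n m : nat}.

Implicit Types (c : 'rV[R]_n -> 'rV[R]_m) (x y u v w p : 'rV[R]_n).

(** Half the squared positive part is convex, with the positive part as a
    derivative that is 1-Lipschitz; these are its descent lemma and its
    subgradient inequality. *)
Lemma half_sqr_pos_ub (a b : R) : Num.max b 0 ^+ 2 / 2 <=
  Num.max a 0 ^+ 2 / 2 + Num.max a 0 * (b - a) + (b - a) ^+ 2 / 2.
Proof.
have := sqr_ge0 (b - a).
by case: (leP a 0) => ha; case: (leP b 0) => hb; nra.
Qed.

Lemma half_sqr_pos_lb (a b : R) :
  Num.max a 0 ^+ 2 / 2 + Num.max a 0 * (b - a) <= Num.max b 0 ^+ 2 / 2.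
Proof.
have := sqr_ge0 (b - a).
by case: (leP a 0) => ha; case: (leP b 0) => hb; nra.
Qed.

Definition penalty (c : 'rV[R]_n -> 'rV[R]_m) x :=
  enorm (pospart (c x)) ^+ 2 / 2.

Definition penalty_grad (c : 'rV[R]_n -> 'rV[R]_m) y :=
  \sum_i pospart (c y) ord0 i *: grad (component c i) y.

Lemma penaltyE c x :
  penalty c x = \sum_i Num.max (component c i x) 0 ^+ 2 / 2.
Proof.
rewrite /penalty sqr_enorm mulr_suml; apply: eq_bigr => i _.
by rewrite mxE -expr2.
Qed.

Lemma edot_penalty_grad c y v : edot (penalty_grad c y) v =
  \sum_i Num.max (component c i y) 0 * edot (grad (component c i) y) v.
Proof.
rewrite edotC edot_sumr; apply: eq_bigr => i _.
by rewrite edotZr mxE edotC.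
Qed.

Lemma penalty_feasible c x : feasible c x -> penalty c x = 0.
Proof.
move=> fx; rewrite penaltyE big1// => i _.
by rewrite max_r ?expr0n ?mul0r//; exact: fx.
Qed.

Lemma penalty_subgradient c x y :
  (forall i, convex_on_space (component c i)) ->
  (forall i, differentiable (component c i) y) ->
  penalty c y + edot (penalty_grad c y) (x - y) <= penalty c x.
Proof.
move=> cvx dif; rewrite !penaltyE edot_penalty_grad -big_split.
apply: ler_sum => i _ /=; apply: le_trans (half_sqr_pos_lb (component c i y) _).
rewrite lerD2l ler_wpM2l ?le_max ?lexx ?orbT//.
by have := convex_gradient_ineq x (cvx i) (dif i); rewrite -lerBrDl.
Qed.

(** At a point of [A] the gradient of [c i] can be longer than [Lc i] when [A]
    has empty interior.  The increment [b - a] of [c i] itself is bounded by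
    [Lc i * enorm (x - y)], and this is what enters the square in
    [half_sqr_pos_ub]; the descent lemma for [c i] bounds the linear term. *)
Lemma penalty_descent (A : set 'rV[R]_n) (Lc Lgc Cb : 'I_m -> R) c x y :
  convex_region A ->
  (forall i, convex_on_space (component c i)) ->
  (forall i, Defs.lipschitz_on (Lc i) A (component c i)) ->
  (forall i, smooth_on (Lgc i) A (component c i)) ->
  (forall i u, A u -> `|component c i u| <= Cb i) ->
  A x -> A y ->
  penalty c x <= penalty c y + edot (penalty_grad c y) (x - y)
    + (\sum_(i < m) (Lc i ^+ 2 + Cb i * Lgc i)) / 2 * enorm (x - y) ^+ 2.
Proof.
move=> cA cvx lip smo bnd Ax Ay.
rewrite !penaltyE edot_penalty_grad -big_split !mulr_suml -big_split.
apply: ler_sum => i _ /=; apply: le_trans (half_sqr_pos_ub (component c i y) _) _.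
have [Lg0 dif lipg] := smo i; have [Lc0 lipc] := lip i.
have := @descent_lemma _ _ A (component c i) (grad (component c i)) (Lgc i) x y
  cA (fun u v Au Av => convex_gradient_ineq u (cvx i) (dif v Av)) lipg Ax Ay.
have := lipc _ _ Ax Ay; have := bnd i _ Ay.
set a := component c i y; set b := component c i x.
set E := enorm (x - y); set D := edot _ _ => hC hL hD.
have E0 : 0 <= E by exact: enorm_ge0.
set p := Num.max a 0.
have p0 : 0 <= p by rewrite le_max lexx orbT.
have pC : p <= Cb i.
  rewrite ge_max (le_trans (ler_norm _) hC)/=; exact: le_trans hC.
have h1 : (b - a) ^+ 2 <= Lc i ^+ 2 * E ^+ 2.
  rewrite -exprMn -[leLHS]real_normK ?num_real// ler_sqr// nnegrE//.
  exact: mulr_ge0.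
have h2 : p * (b - a) <= p * (D + Lgc i / 2 * E ^+ 2).
  by rewrite ler_wpM2l//; lra.
have h3 : p * (Lgc i / 2 * E ^+ 2) <= Cb i * (Lgc i / 2 * E ^+ 2).
  by rewrite ler_wpM2r// mulr_ge0 ?sqr_ge0// divr_ge0.
by lra.
Qed.

Section prox.
Variable psi : 'rV[R]_n -> \bar R.
Hypotheses (psi_proper : Defs.proper psi) (psi_convex : econvex psi).

Lemma edomE u : edom psi u -> psi u = (fine (psi u))%:E.
Proof.
move=> uX; rewrite fineK// fin_numE; apply/andP; split.
  by rewrite gt_eqF//; exact: psi_proper.2.
by rewrite lt_eqF.
Qed.

Lemma edom_convex : convex_region (edom psi).
Proof.
move=> x y t Ax Ay t01; have := psi_convex x y t01.
rewrite (edomE Ax) (edomE Ay) -!EFinM -EFinD => /le_lt_trans; apply.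
exact: ltry.
Qed.

Lemma fine_econvex x y t : edom psi x -> edom psi y -> 0 <= t <= 1 ->
  fine (psi ((1 - t) *: x + t *: y))
  <= (1 - t) * fine (psi x) + t * fine (psi y).
Proof.
move=> Ax Ay t01; have := psi_convex x y t01.
rewrite (edomE Ax) (edomE Ay) (edomE (edom_convex Ax Ay t01)).
by rewrite -!EFinM -EFinD lee_fin.
Qed.

Lemma is_prox_edom gamma v p u :
  0 < gamma -> is_prox gamma psi v p -> edom psi u -> edom psi p.
Proof.
move=> g0 /(_ u) + uX; rewrite (edomE uX) -EFinM -EFinD => h.
rewrite /edom/= ltNge leye_eq; apply/negP => /eqP poo.
by move: h; rewrite poo gt0_muley// addye//.
Qed.

(** Compare the minimizer [p] with the point at parameter [t] on the way to [u]
    and let [t] tend to 0. *)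
Lemma prox_subgradient gamma v p u :
  0 < gamma -> is_prox gamma psi v p -> edom psi u ->
  gamma * (fine (psi p) - fine (psi u)) <= edot (p - v) (u - p).
Proof.
move=> g0 hp uX; have pX := is_prox_edom g0 hp uX.
apply: (@ler_harmonic_limit _ _ _ (2^-1 * edot (u - p) (u - p))) => k.
set t : R := k.+1%:R^-1; have t0 : 0 < t by rewrite invr_gt0.
have t01 : 0 <= t <= 1 by rewrite ltW//= invf_le1// ler1n.
have h0 := hp ((1 - t) *: p + t *: u); move: h0.
rewrite {1}(edomE pX) (edomE (edom_convex pX uX t01)).
rewrite -!EFinM -!EFinD lee_fin !sqr_enorm.
have -> : (1 - t) *: p + t *: u - v = (p - v) + t *: (u - p).
  by apply/rowP => j; rewrite !mxE; ring.
have := ler_wpM2l (ltW g0) (fine_econvex pX uX t01).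
move: (u - p) (p - v) => w q.
rewrite !edotE (edotC w q) => h1 h2.
rewrite -(ler_pM2l t0).
lra.
Qed.

(** Add the optimality inequalities of the two proximal points, each tested at
    the other.  This Lipschitz bound is what makes the proximal step
    measurable. *)
Lemma prox_nonexpansive gamma v p v' p' :
  0 < gamma -> is_prox gamma psi v p -> is_prox gamma psi v' p' ->
  enorm (p - p') <= enorm (v - v').
Proof.
move=> g0 hp hp'; have [[u uX] _] := psi_proper.
have pX := is_prox_edom g0 hp uX; have pX' := is_prox_edom g0 hp' uX.
have := prox_subgradient g0 hp pX'; have := prox_subgradient g0 hp' pX.
move=> h1 h2; have h3 : enorm (p - p') ^+ 2 <= edot (v - v') (p - p').
  by move: h1 h2; rewrite sqr_enorm !edotE (edotC p' p) ; lra.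
have h4 := edot_le (v - v') (p - p').
have [->|e0] := eqVneq (enorm (p - p')) 0; first exact: enorm_ge0.
have e_gt0 : 0 < enorm (p - p') by rewrite lt_neqAle eq_sym e0 enorm_ge0.
by rewrite -(ler_pM2r e_gt0) -expr2 (le_trans h3).
Qed.

End prox.

Section accelerated_step.
Variables (beta gamma rho Lf Lh : R) (x y z z' x' u : 'rV[R]_n).
Hypotheses (beta_ge1 : 1 <= beta)
  (yE : y = (1 - beta^-1) *: x + beta^-1 *: z)
  (x'E : x' = (1 - beta^-1) *: x + beta^-1 *: z').

(** The step from [y] to [x'] is [beta^-1 *: (z' - z)].  In the descent lemma at
    [y], the value at [y] is split with weights [1 - beta^-1] and [beta^-1] and
    compared with [x] and [u]; since [y] is the same combination of [x] and [z],
    the slopes at [x] cancel and only [edot Dg (z' - u)] survives. *)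
Lemma extrapolated_descent (g : 'rV[R]_n -> R) (Dg : 'rV[R]_n) (L : R) :
  (forall w, w = x \/ w = u -> g y + edot Dg (w - y) <= g w) ->
  g x' <= g y + edot Dg (x' - y) + L / 2 * enorm (x' - y) ^+ 2 ->
  g x' <= (1 - beta^-1) * g x + beta^-1 * g u + beta^-1 * edot Dg (z' - u)
    + L / 2 * beta^-1 ^+ 2 * enorm (z' - z) ^+ 2.
Proof.
move=> sub desc.
set th := beta^-1.
have b0 : 0 < beta by apply: lt_le_trans beta_ge1.
have th0 : 0 <= th by rewrite invr_ge0 ltW.
have th1 : 0 <= 1 - th by rewrite subr_ge0 invf_le1.
have x'yE : x' - y = th *: (z' - z).
  by rewrite x'E yE opprD addrACA subrr add0r scalerBr.
have h1 := ler_wpM2l th1 (sub x (or_introl erefl)).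
have h2 := ler_wpM2l th0 (sub u (or_intror erefl)).
move: desc h1 h2; rewrite x'yE enormZ exprMn real_normK ?num_real//.
rewrite yE -/th !edotE; lra.
Qed.

(** With [beta = 2 * L * gamma] for [L = Lf + rho * Lh], the proximal step yields
    [enorm (z' - z) ^+ 2] with twice the coefficient that the descent lemma
    spends; the spare half, kept in the conclusion, serves to absorb noise. *)
Lemma accelerated_step (f s h : 'rV[R]_n -> R) (Df Dh g : 'rV[R]_n) :
  0 <= rho -> 0 < gamma -> beta = 2 * (Lf + rho * Lh) * gamma ->
  (forall w, w = x \/ w = u -> f y + edot Df (w - y) <= f w) ->
  f x' <= f y + edot Df (x' - y) + Lf / 2 * enorm (x' - y) ^+ 2 ->
  (forall w, w = x \/ w = u -> h y + edot Dh (w - y) <= h w) ->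
  h x' <= h y + edot Dh (x' - y) + Lh / 2 * enorm (x' - y) ^+ 2 ->
  h u = 0 ->
  s x' <= (1 - beta^-1) * s x + beta^-1 * s z' ->
  gamma * (s z' - s u) <= edot (z' - (z - gamma *: (g + rho *: Dh))) (u - z') ->
  f x' + s x' + rho * h x' - (f u + s u) <=
    (1 - beta^-1) * (f x + s x + rho * h x - (f u + s u))
    + (Lf + rho * Lh) * beta^-1 ^+ 2
      * (enorm (z - u) ^+ 2 - enorm (z' - u) ^+ 2)
    - beta^-1 * edot (g - Df) (z' - u)
    - (Lf + rho * Lh) / 2 * beta^-1 ^+ 2 * enorm (z' - z) ^+ 2.
Proof.
move=> rho0 g0 bE subf descf subh desch hu0 sx' prox.
have f1 := extrapolated_descent subf descf.
have h1 := ler_wpM2l rho0 (extrapolated_descent subh desch).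
have b0 : 0 < beta by apply: lt_le_trans beta_ge1.
have th0 : 0 < beta^-1 by rewrite invr_gt0.
have p1 : s z' - s u <= 2 * (Lf + rho * Lh) * beta^-1 * edot (z' - z) (u - z')
    + edot (g + rho *: Dh) (u - z').
  rewrite -(ler_pM2l g0) (le_trans prox)//.
  rewrite [X in _ <= X](_ : _ =
    2 * (Lf + rho * Lh) * gamma * beta^-1 * edot (z' - z) (u - z')
    + gamma * edot (g + rho *: Dh) (u - z')); last by ring.
  rewrite -bE divff ?gt_eqF// mul1r !edotE.
  lra.
have := ler_wpM2l (ltW th0) p1.
move: f1 h1 sx'; rewrite hu0 !sqr_enorm !edotE.
rewrite (edotC u z') (edotC u z) (edotC z' z).
by move: (beta^-1) => th; lra.
Qed.

End accelerated_step.
End penalty_and_prox.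

(** * Telescoping the potential *)

Section scalar_recursion.
Context {R : realType}.
Implicit Types (k j : nat).

Lemma powR_three_half (a : R) : 0 <= a -> a `^ (3 / 2) = a * Num.sqrt a.
Proof.
rewrite le_eqVlt => /predU1P[<-|a0]; first by rewrite mul0r powR0// gt_eqF.
rewrite (_ : 3 / 2 = 1 + 2^-1 :> R); last by lra.
by rewrite powRD ?gt_eqF ?implybT// powRr1 ?powR12_sqrt ?ltW.
Qed.

(** Passage from the penalty weight [p] to [p'] at a fixed point, for
    [K = k + 3].  Let [b] and [a] be the coefficients of the two potentials.  The
    increase [b * (p' - p)] of the penalty costs at most two thirds of
    [(a - b) * p], so that [(a - b) * (p * t ^+ 2 / 6 - Lam * t)] is left by the
    lower bound on [e]; as a function of [t] it is at least
    [- (3 / 2) * (a - b) * Lam ^+ 2 / p], which is of order [K ^- 2]. *)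
Lemma penalty_increase (K p p' Lf Lh Lam e t : R) :
  5 <= K -> 0 <= Lf -> 0 < Lh -> 0 <= Lam ->
  p = K * Num.sqrt K -> p' = (K + 1) * Num.sqrt (K + 1) ->
  - Lam * t <= e ->
  (K + 1) * (K - 4) / (Lf + p' * Lh) * (e + p' * (t ^+ 2 / 2)) <=
  K ^+ 2 / (Lf + p * Lh) * (e + p * (t ^+ 2 / 2))
  + 10 * Lam ^+ 2 / Lh * ((K - 1)^-1 - K^-1).
Proof.
move=> K5 Lf0 Lh0 Lam0 pE p'E et.
have K0 : 0 < K by lra.
have sK0 : 0 < Num.sqrt K by rewrite sqrtr_gt0.
have sK'0 : 0 < Num.sqrt (K + 1) by rewrite sqrtr_gt0; lra.
have p0 : 0 < p by rewrite pE mulr_gt0.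
have p'0 : 0 < p' by rewrite p'E mulr_gt0//; lra.
have p2 : p ^+ 2 = K ^+ 3 by rewrite pE exprMn sqr_sqrtr ?(ltW K0)//; ring.
have p'2 : p' ^+ 2 = (K + 1) ^+ 3.
  by rewrite p'E exprMn sqr_sqrtr; [ring|lra].
have pp' : p <= p'.
  by rewrite -ler_sqr ?nnegrE ?(ltW p0) ?(ltW p'0)// p2 p'2; nra.
have rat1 : p' * K <= p * (K + 2).
  have k0 : 0 <= K + 2 by lra.
  rewrite -ler_sqr ?nnegrE ?mulr_ge0 ?(ltW p0) ?(ltW p'0) ?(ltW K0)//.
  by rewrite !exprMn p2 p'2; nra.
have rat2 : p' * K ^+ 2 <= p * (K + 1) ^+ 2.
  have nn (q r : R) : 0 < q -> 0 <= q * r ^+ 2.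
    by move=> q0; rewrite (mulr_ge0 (ltW q0))// sqr_ge0.
  rewrite -ler_sqr ?nnegrE ?nn//.
  rewrite !exprMn p2 p'2 -subr_ge0.
  rewrite [X in 0 <= X](_ : _ = (K + 1) ^+ 3 * K ^+ 3); last by ring.
  by rewrite mulr_ge0// exprn_ge0//; lra.
set l := Lf + p * Lh; set l' := Lf + p' * Lh.
have pLh0 : 0 < p * Lh by rewrite mulr_gt0.
have l0 : 0 < l by rewrite ltr_wpDl.
have l'0 : 0 < l' by rewrite ltr_wpDl// mulr_gt0.
have i0 : 0 < l^-1 by rewrite invr_gt0.
have i'0 : 0 < l'^-1 by rewrite invr_gt0.
have ii' : l'^-1 <= l^-1.
  by rewrite lef_pV2 ?posrE// lerD2l ler_wpM2r// ltW.
have i'i : K ^+ 2 * l^-1 <= (K + 1) ^+ 2 * l'^-1.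
  rewrite ler_pdivrMr// mulrAC ler_pdivlMr// /l /l'.
  have := ler_wpM2r (ltW Lh0) rat2; nra.
have iL : p * Lh * l^-1 <= 1.
  by rewrite ler_pdivrMr// mul1r lerDr.
move: (l^-1) (l'^-1) i0 i'0 ii' i'i iL => i i' i0 i'0 ii' i'i iL.
set a := K ^+ 2 * i; set b := (K + 1) * (K - 4) * i'.
have b0 : 0 <= b by rewrite /b !mulr_ge0 ?(ltW i'0)//; lra.
(* leads to [F1]: the increase of the penalty costs two thirds of [a - b] *)
have F0 : b * (K + 3) <= a * K.
  have h : b <= (K + 1) * (K - 4) * i by rewrite /b ler_wpM2l// mulr_ge0; lra.
  apply: (@le_trans _ _ ((K + 1) * (K - 4) * i * (K + 3))).
    by rewrite ler_wpM2r//; lra.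
  rewrite /a -subr_ge0 [X in 0 <= X](_ : _ = i * (13 * K + 12)); last by ring.
  by rewrite mulr_ge0 ?(ltW i0)//; lra.
have ab : 0 <= a - b.
  by rewrite -(pmulr_lge0 _ K0); nra.
have F1 : b * (p' - p) <= 2 / 3 * (a - b) * p.
  rewrite -(ler_pM2r K0).
  have h1 : b * (p' * K) <= b * (p * (K + 2)) by rewrite ler_wpM2l.
  have h2 : p * (b * (K + 3)) <= p * (a * K) by rewrite ler_wpM2l// ltW.
  nra.
have F2 : a - b <= 5 * K * i.
  have h : (K - 4) * (K ^+ 2 * i) <= (K + 1) * b.
    rewrite /b; have k0 : 0 <= K - 4 by lra.
    have := ler_wpM2l k0 i'i; nra.
  have K1 : 0 < K + 1 by lra.
  rewrite -(ler_pM2l K1) mulrBr.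
  apply: (@le_trans _ _ (5 * (K ^+ 2 * i))); first by rewrite /a; lra.
  nra.
have F3 : (a - b) * (3 / 2 * Lam ^+ 2) <=
    p * (10 * Lam ^+ 2 / Lh * ((K - 1)^-1 - K^-1)).
  have L2 : 0 <= Lam ^+ 2 by exact: sqr_ge0.
  apply: (@le_trans _ _ (5 * K * i * (3 / 2 * Lam ^+ 2))).
    by rewrite ler_wpM2r// mulr_ge0//; lra.
  have -> : p * (10 * Lam ^+ 2 / Lh * ((K - 1)^-1 - K^-1)) =
     Lam ^+ 2 * (10 * p / (Lh * (K * (K - 1)))).
    by field; rewrite !gt_eqF//; lra.
  rewrite [leLHS](_ : _ = Lam ^+ 2 * (15 / 2 * K * i)); last by lra.
  rewrite ler_wpM2l// ler_pdivlMr; last by rewrite !mulr_gt0//; lra.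
  rewrite -(ler_pM2r p0).
  rewrite [leLHS](_ : _ = 15 / 2 * K ^+ 2 * (K - 1) * (p * Lh * i)); last by ring.
  rewrite [leRHS](_ : _ = 10 * K ^+ 3); last by rewrite -p2; ring.
  apply: (@le_trans _ _ (15 / 2 * K ^+ 2 * (K - 1))).
    by rewrite ler_piMr// !mulr_ge0 ?sqr_ge0//; lra.
  nra.
have F4 : 0 <= (a - b) * ((p * t - 3 * Lam) ^+ 2 / 6).
  by rewrite mulr_ge0// divr_ge0 ?sqr_ge0.
have F5 := ler_wpM2l ab et.
have t2 : 0 <= p * (t ^+ 2 / 2) by rewrite mulr_ge0 ?(ltW p0)// divr_ge0 ?sqr_ge0.
have F6 := ler_wpM2r t2 F1.
have F7 := ler_wpM2l (ltW p0) F5.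
rewrite -(ler_pM2l p0).
move: F3 F4 F6 F7.
move: (10 * Lam ^+ 2 / Lh * _) => E.
move: a b {b0 F0 ab F1 F2 F5} => a b.
lra.
Qed.

Section recursion.
Variables (Lf Lh Lam : R) (rho beta : nat -> R).
Hypotheses (Lf0 : 0 <= Lf) (Lh0 : 0 < Lh) (Lam0 : 0 <= Lam)
  (rhoE : forall k, (1 <= k)%N -> rho k = (k%:R + 4) `^ (3 / 2))
  (betaE : forall k, (1 <= k)%N -> beta k = (k%:R + 4) / 5).

Let L k := Lf + rho k * Lh.

Lemma rho_gt0 k : (1 <= k)%N -> 0 < rho k.
Proof. by move=> k1; rewrite rhoE// powR_gt0// ltr_wpDl. Qed.

Lemma L_gt0 k : (1 <= k)%N -> 0 < L k.
Proof. by move=> k1; rewrite /L ltr_wpDl// mulr_gt0// rho_gt0. Qed.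

Lemma beta_ge1 k : (1 <= k)%N -> 1 <= beta k.
Proof.
move=> k1; rewrite betaE// ler_pdivlMr// mul1r.
have : 1 <= k%:R :> R by rewrite ler1n.
lra.
Qed.

(** Proportional to [beta k ^+ 2 / L k], the weight for which the squared
    distances get the same coefficient at every iteration. *)
Definition step_weight k : R := (k%:R + 4) ^+ 2 / L k.

Lemma step_weight_ge0 k : (1 <= k)%N -> 0 <= step_weight k.
Proof. by move=> k1; rewrite divr_ge0 ?sqr_ge0// ltW ?L_gt0. Qed.

(** The weighted one-step inequalities telescope: the coefficient of the
    squared distances is [25] at every step, the initial potential is multiplied
    by [1 - (beta 1)^-1 = 0], and the costs of the penalty increases, in the
    form [10 * Lam ^+ 2 / Lh * ((k + 2)^-1 - (k + 3)^-1)], telescope as well. *)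
Lemma potential_bound (e t D nu : nat -> R) :
  (forall k, (1 <= k)%N -> 0 <= D k) ->
  (forall k, (1 <= k)%N -> - Lam * t k <= e k) ->
  (forall k, (1 <= k)%N ->
     e k.+1 + rho k * (t k.+1 ^+ 2 / 2) <=
     (1 - (beta k)^-1) * (e k + rho k * (t k ^+ 2 / 2))
     + L k * (beta k)^-1 ^+ 2 * (D k - D k.+1) + nu k) ->
  forall j, (1 <= j)%N ->
  step_weight j * (e j.+1 + rho j * (t j.+1 ^+ 2 / 2)) <=
  25 * D 1 + 10 * Lam ^+ 2 / Lh + \sum_(1 <= k < j.+1) step_weight k * nu k.
Proof.
move=> D0 low step j j1.
suff main : step_weight j * (e j.+1 + rho j * (t j.+1 ^+ 2 / 2)) + 25 * D j.+1
    <= 25 * D 1 + 10 * Lam ^+ 2 / Lh * (1 - (j%:R + 3)^-1)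
    + \sum_(1 <= k < j.+1) step_weight k * nu k.
  have h1 := D0 j.+1 isT.
  have h2 : 10 * Lam ^+ 2 / Lh * (1 - (j%:R + 3)^-1) <= 10 * Lam ^+ 2 / Lh.
    apply: ler_piMr.
      by rewrite divr_ge0 ?(ltW Lh0)// mulr_ge0 ?sqr_ge0.
    by rewrite lerBlDr lerDl invr_ge0 addr_ge0.
  lra.
have wstep k : (1 <= k)%N ->
    step_weight k * (e k.+1 + rho k * (t k.+1 ^+ 2 / 2)) + 25 * D k.+1 <=
    (k%:R + 4) * (k%:R - 1) / L k * (e k + rho k * (t k ^+ 2 / 2)) + 25 * D k
    + step_weight k * nu k.
  move=> k1; have := ler_wpM2l (step_weight_ge0 k1) (step k k1).
  have k4 : k%:R + 4 != 0 :> R by rewrite gt_eqF// ltr_wpDl.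
  have Lk := L_gt0 k1.
  have e1 : step_weight k * (1 - (beta k)^-1) = (k%:R + 4) * (k%:R - 1) / L k.
    by rewrite /step_weight betaE//; field; rewrite k4 gt_eqF.
  have e2 : step_weight k * (L k * (beta k)^-1 ^+ 2) = 25.
    by rewrite /step_weight betaE//; field; rewrite k4 gt_eqF.
  rewrite [X in _ <= X -> _](_ : _ =
    step_weight k * (1 - (beta k)^-1) * (e k + rho k * (t k ^+ 2 / 2))
    + step_weight k * (L k * (beta k)^-1 ^+ 2) * (D k - D k.+1)
    + step_weight k * nu k); last by move: (beta k)^-1 => b; ring.
  by rewrite e1 e2; lra.
elim: j j1 => [//|j IH] _.
have := wstep j.+1 isT; rewrite big_nat_recr//=.
case: j IH => [_|j /(_ isT) IH].
  rewrite subrr mulr0 mul0r mul0r add0r big_nil add0r => h; apply: (le_trans h).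
  rewrite lerD2r lerDl mulr_ge0//.
    by rewrite divr_ge0 ?(ltW Lh0)// mulr_ge0 ?sqr_ge0.
  by rewrite subr_ge0 invf_le1; lra.
set K : R := j.+1%:R + 4.
have K5 : 5 <= K.
  by have : 1 <= j.+1%:R :> R by [rewrite ler1n]; rewrite /K; lra.
have r1 : rho j.+1 = K * Num.sqrt K by rewrite rhoE// powR_three_half//; lra.
have jE : j.+2%:R = j.+1%:R + 1 :> R by rewrite -[j.+2%:R]natr1.
have r2 : rho j.+2 = (K + 1) * Num.sqrt (K + 1).
  have KE : j.+2%:R + 4 = K + 1 :> R by rewrite jE /K; lra.
  by rewrite rhoE// KE powR_three_half//; lra.
have := penalty_increase K5 Lf0 Lh0 Lam0 r1 r2 (low j.+2 isT).
rewrite -/(L j.+1) -/(L j.+2) -/(step_weight j.+1).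
have -> : j.+2%:R + 4 = K + 1 :> R by rewrite jE /K; lra.
have -> : j.+2%:R - 1 = K - 4 :> R by rewrite jE /K; lra.
have -> : j.+2%:R + 3 = K :> R by rewrite jE /K; lra.
move: IH; have -> : j.+1%:R + 3 = K - 1 :> R by rewrite /K; lra.
lra.
Qed.

Lemma step_weightV j : (1 <= j)%N -> (step_weight j)^-1 =
  Lf * (j%:R + 4) ^- 2 + Lh * (Num.sqrt (j%:R + 4))^-1.
Proof.
move=> j1; rewrite /step_weight invf_div /L rhoE// powR_three_half ?addr_ge0//.
set K := j%:R + 4; have K0 : 0 < K by rewrite ltr_wpDl.
have s0 : Num.sqrt K != 0 by rewrite gt_eqF// sqrtr_gt0.
have KE : K = Num.sqrt K ^+ 2 by rewrite sqr_sqrtr// ltW.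
by rewrite [in RHS]KE [in LHS]KE sqrtr_sqr ger0_norm ?sqrtr_ge0//; field.
Qed.

(** [step_weight k / beta k] is at most [5 / (Lh * sqrt (k + 4))], and
    [1 / sqrt a] is at most twice the increment of the square root between
    [a - 1] and [a]. *)
Lemma sum_bounded_noise (B : R) j : (1 <= j)%N -> 0 <= B ->
  \sum_(1 <= k < j.+1) step_weight k * ((beta k)^-1 * B)
  <= 10 * B / Lh * Num.sqrt (j%:R + 4).
Proof.
move=> + B0; elim: j => [//|j IH] _.
rewrite big_nat_recr//=.
set K := j.+1%:R + 4 : R.
have K0 : 0 < K by rewrite ltr_wpDl.
set b := Num.sqrt K; have b0 : 0 < b by rewrite sqrtr_gt0.
pose a : R := Num.sqrt (j%:R + 4); have a0 : 0 < a by rewrite sqrtr_gt0 ltr_wpDl.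
have bE : b ^+ 2 = K by rewrite sqr_sqrtr// ltW.
have aE : a ^+ 2 = K - 1.
  by rewrite sqr_sqrtr ?addr_ge0// /K -[j.+1%:R]natr1; ring.
have BL : 0 <= 10 * B / Lh by rewrite divr_ge0 ?(ltW Lh0)// mulr_ge0.
have h1 : \sum_(1 <= k < j.+1) step_weight k * ((beta k)^-1 * B) <=
    10 * B / Lh * a.
  by case: j IH @K {K0} @b {b0} bE @a {a0} aE => [|j] IH *;
    [rewrite big_nil mulr_ge0 ?sqrtr_ge0|exact: IH].
(* [(2 * b)^-1] is a lower bound for the increment [b - a] *)
have h2 : step_weight j.+1 * ((beta j.+1)^-1 * B) <= 10 * B / Lh * (2 * b)^-1.
  rewrite betaE// /step_weight -/K.
  have -> : K ^+ 2 / L j.+1 * ((K / 5)^-1 * B) = 5 * B * (K / L j.+1).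
    by field; rewrite !gt_eqF ?L_gt0.
  have -> : 10 * B / Lh * (2 * b)^-1 = 5 * B * (Lh * b)^-1.
    by field; rewrite !gt_eqF.
  rewrite ler_wpM2l ?mulr_ge0// ler_pdivrMr ?L_gt0//.
  rewrite mulrC ler_pdivlMr ?mulr_gt0// /L rhoE// powR_three_half ?(ltW K0)//.
  by rewrite -/K -/b mulrA mulrAC lerDr.
apply: (le_trans (lerD h1 h2)); rewrite -mulrDr ler_wpM2l//.
rewrite -lerBrDl -[leLHS]mul1r ler_pdivrMr ?mulr_gt0//.
nra.
Qed.

(** Here [step_weight k / L k <= 1 / (Lh ^+ 2 * (k + 4))], a harmonic sum that is
    dominated by the logarithm. *)
Lemma sum_variance (v : R) j : 0 <= v ->
  \sum_(1 <= k < j.+1) step_weight k * (v / (2 * L k))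
  <= v / (2 * Lh ^+ 2) * ln (j.+1%:R).
Proof.
move=> v0; elim: j => [|j IH]; first by rewrite big_nil ln1 mulr0.
rewrite big_nat_recr//=.
set K := j.+1%:R + 4 : R.
have K0 : 0 < K by rewrite ltr_wpDl.
set b := Num.sqrt K; have b0 : 0 < b by rewrite sqrtr_gt0.
have bE : K = b ^+ 2 by rewrite sqr_sqrtr// ltW.
have h2 : step_weight j.+1 * (v / (2 * L j.+1)) <= v / (2 * Lh ^+ 2) * K^-1.
  rewrite /step_weight -/K.
  have -> : K ^+ 2 / L j.+1 * (v / (2 * L j.+1)) = v / 2 * (K / L j.+1) ^+ 2.
    by field; rewrite !gt_eqF ?L_gt0.
  have -> : v / (2 * Lh ^+ 2) * K^-1 = v / 2 * (Lh * b)^-1 ^+ 2.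
    by rewrite bE; field; rewrite !gt_eqF.
  rewrite ler_wpM2l ?divr_ge0// ler_sqr ?nnegrE; first last.
  - by rewrite invr_ge0 mulr_ge0 ?ltW.
  - by rewrite divr_ge0 ?ltW ?L_gt0.
  rewrite ler_pdivrMr ?L_gt0//.
  rewrite mulrC ler_pdivlMr ?mulr_gt0// /L rhoE// powR_three_half ?(ltW K0)//.
  by rewrite -/K -/b mulrA mulrAC lerDr.
have h3 : K^-1 <= ln j.+2%:R - ln j.+1%:R.
  have j0 : 0 < j.+2%:R :> R by [].
  have h : - ln (j.+2%:R) + ln j.+1%:R = ln (1 + (- j.+2%:R^-1)) :> R.
    rewrite addrC -lnV ?posrE// -lnM ?posrE ?invr_gt0//; congr ln.
    have j1 : 0 < j.+1%:R :> R by [].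
    by rewrite -[j.+2%:R]natr1; move: j.+1%:R j1 => a a0; field; lra.
  have : ln (1 + (- j.+2%:R^-1)) <= - j.+2%:R^-1 :> R.
    by apply: le_ln1Dx; rewrite ltrN2 invf_lt1// ltr1n.
  rewrite -h => h'.
  have : K^-1 <= j.+2%:R^-1.
    by rewrite lef_pV2 ?posrE// /K -[j.+2%:R]natr1; lra.
  move: h'; move: (ln _) (ln _) (j.+2%:R^-1) (K^-1) => ? ? ? ?; lra.
have c0 : 0 <= v / (2 * Lh ^+ 2) by rewrite divr_ge0// mulr_ge0 ?sqr_ge0.
have := ler_wpM2l c0 h3; move: IH h2; rewrite mulrBr; lra.
Qed.

End recursion.
End scalar_recursion.

(** * Explicit rates *)

Section rates.
Context {R : realType}.
Implicit Types (k : nat).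

Lemma quarter_powers k : (1 <= k)%N ->
  let p : R := (k%:R `^ (1 / 4))^-1 in
  [/\ 0 < p, k%:R^-1 = p ^+ 4 & forall i : nat, k%:R `^ (- (i%:R / 4)) = p ^+ i].
Proof.
move=> k1 p; have k0 : 0 < k%:R :> R by rewrite ltr0n.
have p0 : 0 < p by rewrite invr_gt0 powR_gt0.
have pE (i : nat) : k%:R `^ (- (i%:R / 4)) = p ^+ i.
  rewrite powRN exprVn; congr (_^-1).
  by rewrite -powR_mulrn ?powR_ge0// -powRrM; congr (_ `^ _); ring.
split=> //; rewrite -pE (_ : 4%:R / 4 = 1) ?powRN ?powRr1//.
by rewrite divff.
Qed.

(** All exponents of [k] in the rates are multiples of [1 / 4].  Comparing the
    powers of [K = k + 3], which the recursion produces, with powers of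
    [p = k ^ (- 1 / 4)] turns the final estimates into polynomial ones. *)
Lemma shifted_powers (p : R) k : (1 <= k)%N -> 0 < p -> k%:R^-1 = p ^+ 4 ->
  let K : R := k.-1%:R + 4 in
  [/\ K ^- 2 <= p ^+ 8, (Num.sqrt K)^-1 <= p ^+ 2 & p ^- 6 <= K * Num.sqrt K].
Proof.
move=> k1 p0 kE K.
have KE : K = k%:R + 3 by rewrite /K -{2}(prednK k1) -[k.-1.+1%:R]natr1; ring.
have k0 : 0 < k%:R :> R by rewrite ltr0n.
have kp : k%:R = p ^- 4 by rewrite -kE invrK.
have kK : k%:R <= K by rewrite KE lerDl.
have K0 : 0 < K by apply: lt_le_trans kK.
have sk : Num.sqrt k%:R = p ^- 2.
  have -> : k%:R = (p ^- 2) ^+ 2 by rewrite kp; field; rewrite gt_eqF.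
  by rewrite sqrtr_sqr ger0_norm// invr_ge0 exprn_ge0// ltW.
have skK : p ^- 2 <= Num.sqrt K by rewrite -sk ler_wsqrtr.
have p20 : 0 < p ^- 2 by rewrite invr_gt0 exprn_gt0.
split.
- rewrite (_ : p ^+ 8 = (p ^- 4) ^- 2); last by field; rewrite gt_eqF.
  rewrite -kp lef_pV2 ?posrE ?exprn_gt0//.
  by rewrite ler_sqr ?nnegrE ?(ltW k0) ?(ltW K0).
- rewrite -[p ^+ 2]invrK lef_pV2 ?posrE//.
  exact: lt_le_trans p20 skK.
- rewrite (_ : p ^- 6 = p ^- 4 * p ^- 2); last by field; rewrite gt_eqF.
  by rewrite -kp ler_pM// ltW.
Qed.

Lemma sum_sqr_le_sqr_sum (a b c d : R) : 0 <= a -> 0 <= b -> 0 <= c -> 0 <= d ->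
  a ^+ 2 + b ^+ 2 + c ^+ 2 + d ^+ 2 <= (a + b + c + d) ^+ 2.
Proof.
move=> a0 b0 c0 d0.
have ab := mulr_ge0 a0 b0; have ac := mulr_ge0 a0 c0.
have ad := mulr_ge0 a0 d0; have bc := mulr_ge0 b0 c0.
have bd := mulr_ge0 b0 d0; have cd := mulr_ge0 c0 d0.
lra.
Qed.

(** At [tau = 2 * Lam / r + S] the quadratic equals [tau * (r * S / 2)], which is
    at least [r * S ^+ 2 / 2]. *)
Lemma quadratic_at_shift (r Lam S M tau : R) :
  0 < r -> 0 <= Lam -> 0 < S -> tau = 2 * Lam / r + S ->
  M <= r * S ^+ 2 / 2 ->
  M <= r * tau ^+ 2 / 2 - Lam * tau /\ Lam < r * tau.
Proof.
move=> r0 Lam0 S0 -> MS; split.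
  apply: (le_trans MS).
  rewrite -subr_ge0 [X in 0 <= X](_ : _ = Lam * S).
    by rewrite mulr_ge0// ltW.
  by field; rewrite gt_eqF.
have -> : r * (2 * Lam / r + S) = 2 * Lam + r * S by field; rewrite gt_eqF.
by have := mulr_gt0 r0 S0; lra.
Qed.

(** The tangent at [tau] to the quadratic [r * t ^+ 2 / 2 - Lam * t]: unlike
    the exact solution of the quadratic inequality, this bound on [t] is
    affine in [W] and passes through expectations. *)
Lemma tangent_bound (r rho Lam t tau e W : R) : 0 <= r -> r <= rho ->
  - Lam * t <= e -> e + rho * (t ^+ 2 / 2) <= W ->
  t * (r * tau - Lam) <= W + r * tau ^+ 2 / 2.
Proof.
move=> r0 rrho et eW.
have t2 : 0 <= t ^+ 2 / 2 by rewrite divr_ge0 ?sqr_ge0.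
have h1 := ler_wpM2r t2 rrho.
have h2 : 0 <= r * (t - tau) ^+ 2 by rewrite mulr_ge0 ?sqr_ge0.
lra.
Qed.

Section bounds.
Variables (Lf Lh Lam DX : R) (rho beta : nat -> R).
Hypotheses (Lf0 : 0 <= Lf) (Lh0 : 0 < Lh) (Lam0 : 0 <= Lam) (DX0 : 0 < DX)
  (rhoE : forall k, (1 <= k)%N -> rho k = (k%:R + 4) `^ (3 / 2)).

Let C1 := 25 * DX ^+ 2 + 10 * Lam ^+ 2 / Lh.

Let C1_gt0 : 0 < C1.
Proof.
rewrite ltr_pwDl//; first by rewrite mulr_gt0// exprn_gt0.
by rewrite divr_ge0 ?(ltW Lh0)// mulr_ge0// sqr_ge0.
Qed.

Lemma weighted_bound k Q B : (1 <= k)%N ->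
  step_weight Lf Lh rho k * Q <= B -> Q <= (step_weight Lf Lh rho k)^-1 * B.
Proof.
move=> k1 QB; have w0 : 0 < step_weight Lf Lh rho k.
  rewrite divr_gt0 ?exprn_gt0 ?ltr_wpDl//.
  by rewrite mulr_gt0// rhoE// powR_gt0// ltr_wpDl.
by rewrite mulrC ler_pdivlMr// mulrC.
Qed.

Section violation.
Variable G : R.
Hypothesis G0 : 0 < G.
Let C2 := 20 * G * DX * Lf / (Num.sqrt 6 * Lh) + 120 * G * DX.

(** The three terms of the bound other than [2 * Lam * k ^ (- 3 / 2)] form the
    [S] of [quadratic_at_shift], for [r = k ^ (3 / 2)]; the sum of their squares,
    times [r / 2], dominates the bound on the potential. *)
Lemma violation_rate k (e t : R) : (2 <= k)%N -> 0 <= t -> - Lam * t <= e ->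
  step_weight Lf Lh rho k.-1 * (e + rho k.-1 * (t ^+ 2 / 2)) <=
    C1 + 10 * (2 * G * DX) / Lh * Num.sqrt (k.-1%:R + 4) ->
  t <= Num.sqrt (2 * C2) * k%:R `^ (- (3 / 4))
          + 2 * Num.sqrt (C1 * Lh) * k%:R^-1
          + 2 * Lam * k%:R `^ (- (3 / 2))
          + 2 * Num.sqrt (C1 * Lf) * k%:R `^ (- (7 / 4)).
Proof.
case: k => [//|[//|k _]]; set k2 := k.+2 => t0 et QB.
have [p0 kE pE] := @quarter_powers k2 isT.
rewrite kE (pE 3%N) (_ : 3 / 2 = 6%:R / 4); last by field.
rewrite (pE 6%N) (pE 7%N); move: (_^-1) p0 kE {pE} => p p0 kE.
have [A1 A2 rK] := @shifted_powers p k2 isT p0 kE.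
have := weighted_bound (isT : (1 <= k2.-1)%N) QB.
rewrite step_weightV// => Q.
set K : R := k2.-1%:R + 4 in A1 A2 rK Q *.
have K5 : 5 <= K by rewrite /K /= -natr1; have := ler0n R k; lra.
have GD : 0 < G * DX by rewrite mulr_gt0.
have sK0 : 0 < Num.sqrt K by rewrite sqrtr_gt0; lra.
have s60 : 0 < Num.sqrt 6 :> R by rewrite sqrtr_gt0.
have C20 : 0 <= C2.
  rewrite addr_ge0//; last by rewrite -mulrA mulr_ge0// ltW.
  by rewrite divr_ge0 ?(mulr_ge0 _ Lf0) ?mulr_ge0 ?ltW.
set a := Num.sqrt (2 * C2) * p ^+ 3; set b := 2 * Num.sqrt (C1 * Lh) * p ^+ 4.
set c := 2 * Num.sqrt (C1 * Lf) * p ^+ 7.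
have pn i : 0 < p ^+ i by rewrite exprn_gt0.
have a0 : 0 <= a by rewrite mulr_ge0 ?sqrtr_ge0// ltW.
have c0 : 0 <= c by rewrite !mulr_ge0 ?sqrtr_ge0// ltW.
have b0 : 0 < b by rewrite !mulr_gt0// sqrtr_gt0 mulr_gt0.
have r0 : 0 < p ^- 6 by rewrite invr_gt0.
have a2 : a ^+ 2 = 2 * C2 * p ^+ 6.
  by rewrite exprMn sqr_sqrtr ?mulr_ge0//; ring.
have b2 : b ^+ 2 = 4 * (C1 * Lh) * p ^+ 8.
  by rewrite !exprMn sqr_sqrtr ?mulr_ge0 ?ltW//; ring.
have c2 : c ^+ 2 = 4 * (C1 * Lf) * p ^+ 14.
  by rewrite !exprMn sqr_sqrtr ?mulr_ge0 ?(ltW C1_gt0)//; ring.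
pose M := C1 * Lf * p ^+ 8 + C1 * Lh * p ^+ 2 + C2.
have MS : M <= p ^- 6 * (a + b + c) ^+ 2 / 2.
  have h := ler_wpM2l (ltW r0) (sum_sqr_le_sqr_sum a0 (ltW b0) c0 (lexx 0)).
  rewrite expr0n addr0 addr0 a2 b2 c2 in h.
  rewrite ler_pdivlMr//; apply: le_trans h.
  rewrite -subr_ge0 [X in 0 <= X](_ : _ =
    2 * (C1 * Lf * p ^+ 8) + 2 * (C1 * Lh * p ^+ 2)).
    have X2 : 0 <= C1 * Lh * p ^+ 2 by rewrite !mulr_ge0// ltW.
    have X4 : 0 <= C1 * Lf * p ^+ 8 by rewrite !mulr_ge0// ltW.
    lra.
  by rewrite /M; field; rewrite gt_eqF.
have WM : (Lf * K ^- 2 + Lh * (Num.sqrt K)^-1)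
    * (C1 + 10 * (2 * G * DX) / Lh * Num.sqrt K) <= M.
  have B1 : K ^- 2 * Num.sqrt K <= (Num.sqrt 6)^-1.
    rewrite -[leRHS]mul1r ler_pdivlMr// -mulrA mulrC ler_pdivrMr ?exprn_gt0//;
      last by lra.
    rewrite mul1r -ler_sqr ?nnegrE ?sqr_ge0 ?mulr_ge0 ?sqrtr_ge0//.
    rewrite exprMn !sqr_sqrtr//; last by lra.
    have h : K * 6 <= K ^+ 2 * K ^+ 2 by rewrite ler_pM//; nra.
    lra.
  have h1 : Lf * C1 * K ^- 2 <= Lf * C1 * p ^+ 8.
    by rewrite ler_wpM2l// mulr_ge0// ltW.
  have h2 : Lh * C1 * (Num.sqrt K)^-1 <= Lh * C1 * p ^+ 2.
    by rewrite ler_wpM2l// mulr_ge0// ltW.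
  have h3 : 20 * (G * DX) * Lf / Lh * (K ^- 2 * Num.sqrt K) <=
      20 * (G * DX) * Lf / Lh * (Num.sqrt 6)^-1.
    apply: ler_wpM2l B1; rewrite divr_ge0 ?(ltW Lh0)// mulr_ge0//.
    by rewrite mulr_ge0// ltW.
  rewrite [leLHS](_ : _ = Lf * C1 * K ^- 2 + Lh * C1 * (Num.sqrt K)^-1 +
    20 * (G * DX) * Lf / Lh * (K ^- 2 * Num.sqrt K) + 20 * (G * DX)); last first.
    by field; rewrite !gt_eqF//; lra.
  rewrite /M [C2](_ : _ = 20 * (G * DX) * Lf / Lh * (Num.sqrt 6)^-1
    + 120 * (G * DX)); last by rewrite /C2; field; rewrite !gt_eqF.
  lra.
set tau := (X in t <= X).
have S0 : 0 < a + b + c by rewrite ltr_wpDr// ltr_wpDl.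
have tauE : tau = 2 * Lam / p ^- 6 + (a + b + c) by rewrite invrK /tau; ring.
have [h1 h2] := quadratic_at_shift r0 Lam0 S0 tauE MS.
have rrho : p ^- 6 <= rho k.+1 by rewrite rhoE// powR_three_half ?addr_ge0.
have h3 := tangent_bound tau (ltW r0) rrho et (le_trans Q WM).
rewrite -subr_gt0 in h2; rewrite -(ler_pM2r h2) (le_trans h3)//.
lra.
Qed.

End violation.

Section mean.
Variable sigma : R.
Hypothesis sigma0 : 0 < sigma.

Let mean_bound k := (step_weight Lf Lh rho k.-1)^-1
  * (C1 + sigma ^+ 2 / (2 * Lh ^+ 2) * ln k%:R).

Lemma mean_upper_rate k : (2 <= k)%N -> mean_bound k <=
  3 * Num.sqrt 3 * sigma ^+ 2 * Lh^-1 * k%:R `^ (- (1 / 2)) * ln k%:R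
  + 2 * Num.sqrt 3 * C1 * Lh * k%:R `^ (- (1 / 2))
  + 3 * sigma ^+ 2 * Lf * Lh ^- 2 * k%:R ^- 2 * ln k%:R
  + 2 * C1 * Lf * k%:R ^- 2.
Proof.
case: k => [//|[//|k _]]; set k2 := k.+2.
have [p0 kE pE] := @quarter_powers k2 isT.
rewrite /mean_bound step_weightV// (_ : 1 / 2 = 2%:R / 4); last by field.
rewrite -[k2%:R ^- 2]exprVn kE (pE 2%N); move: (_^-1) p0 kE {pE} => p p0 kE.
have [A1 A2 _] := @shifted_powers p k2 isT p0 kE.
have ln0 : 0 <= ln k2%:R :> R by rewrite ln_ge0// ler1n.
have s3 : 1 <= Num.sqrt 3 :> R by rewrite -[leLHS]sqrtr1 ler_wsqrtr// ler1n.
move: (ln _) ln0 => l l0.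
set K : R := k2.-1%:R + 4 in A1 A2 *.
have V0 : 0 <= C1 + sigma ^+ 2 / (2 * Lh ^+ 2) * l.
  rewrite addr_ge0 ?(ltW C1_gt0)// mulr_ge0// divr_ge0 ?sqr_ge0//.
  by rewrite mulr_ge0 ?sqr_ge0.
have B : Lf * K ^- 2 + Lh * (Num.sqrt K)^-1 <= Lf * p ^+ 8 + Lh * p ^+ 2.
  by rewrite lerD// ler_wpM2l// ltW.
apply: (le_trans (ler_wpM2r V0 B)).
have pn i : 0 < p ^+ i by rewrite exprn_gt0.
have X1 : 0 <= sigma ^+ 2 * Lh^-1 * p ^+ 2 * l.
  by rewrite !mulr_ge0 ?sqr_ge0 ?invr_ge0// ltW.
have X2 : 0 <= C1 * Lh * p ^+ 2 by rewrite !mulr_ge0// ltW.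
have X3 : 0 <= sigma ^+ 2 * Lf * Lh ^- 2 * p ^+ 8 * l.
  by rewrite !mulr_ge0 ?sqr_ge0 ?invr_ge0 ?sqr_ge0// ltW.
have X4 : 0 <= C1 * Lf * p ^+ 8 by rewrite !mulr_ge0// ltW.
have Y1 := ler_wpM2r X1 s3; have Y2 := ler_wpM2r X2 s3.
rewrite [leLHS](_ : _ = 1 / 2 * (sigma ^+ 2 * Lh^-1 * p ^+ 2 * l)
  + C1 * Lh * p ^+ 2 + 1 / 2 * (sigma ^+ 2 * Lf * Lh ^- 2 * p ^+ 8 * l)
  + C1 * Lf * p ^+ 8); last by field; rewrite gt_eqF.
rewrite -exprM; move: (Lh^-1) (Lh ^- 2) X1 X3 Y1 Y2 => Li Li2 X1 X3 Y1 Y2.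
lra.
Qed.

(** The choice [r = k ^ (3 / 2)] and the argument are those of [violation_rate];
    the conclusion is kept in the form required by [tangent_bound], for which
    [r * tau - Lam] has to be positive. *)
Lemma mean_lower_rate k : (2 <= k)%N ->
  let tau := Num.sqrt 6 * sigma * (Num.sqrt Lh)^-1 * k%:R^-1
             * Num.sqrt (ln k%:R)
           + 2 * Num.sqrt (C1 * Lh) * k%:R^-1
           + 2 * Lam * k%:R `^ (- (3 / 2))
           + sigma * Lh^-1 * Num.sqrt (6 * Lf) * k%:R `^ (- (7 / 4))
             * Num.sqrt (ln k%:R)
           + 2 * Num.sqrt (C1 * Lf) * k%:R `^ (- (7 / 4)) in
  exists r : R, [/\ 0 < r, r <= rho k.-1, Lam < r * tau &
    mean_bound k <= r * tau ^+ 2 / 2 - Lam * tau].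
Proof.
case: k => [//|[//|k _]]; set k2 := k.+2.
have [p0 kE pE] := @quarter_powers k2 isT.
rewrite /mean_bound step_weightV// kE (_ : 3 / 2 = 6%:R / 4); last by field.
rewrite (pE 6%N) (pE 7%N); move: (_^-1) p0 kE {pE} => p p0 kE.
have [A1 A2 rK] := @shifted_powers p k2 isT p0 kE.
have ln0 : 0 <= ln k2%:R :> R by rewrite ln_ge0// ler1n.
move: (ln _) ln0 => l l0.
set K : R := k2.-1%:R + 4 in A1 A2 rK *.
have V0 : 0 <= C1 + sigma ^+ 2 / (2 * Lh ^+ 2) * l.
  rewrite addr_ge0 ?(ltW C1_gt0)// mulr_ge0// divr_ge0 ?sqr_ge0//.
  by rewrite mulr_ge0 ?sqr_ge0.
have B : Lf * K ^- 2 + Lh * (Num.sqrt K)^-1 <= Lf * p ^+ 8 + Lh * p ^+ 2.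
  by rewrite lerD// ler_wpM2l// ltW.
have r0 : 0 < p ^- 6 by rewrite invr_gt0 exprn_gt0.
set a := Num.sqrt 6 * sigma * (Num.sqrt Lh)^-1 * p ^+ 4 * Num.sqrt l.
set b := 2 * Num.sqrt (C1 * Lh) * p ^+ 4.
set c := sigma * Lh^-1 * Num.sqrt (6 * Lf) * p ^+ 7 * Num.sqrt l.
set d := 2 * Num.sqrt (C1 * Lf) * p ^+ 7.
have pn i : 0 < p ^+ i by rewrite exprn_gt0.
have a0 : 0 <= a by rewrite !mulr_ge0 ?invr_ge0 ?sqrtr_ge0// ltW.
have b0 : 0 < b by rewrite !mulr_gt0// sqrtr_gt0 mulr_gt0.
have c0 : 0 <= c by rewrite !mulr_ge0 ?invr_ge0 ?sqrtr_ge0// ltW.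
have d0 : 0 <= d by rewrite !mulr_ge0 ?sqrtr_ge0// ltW.
have a2 : a ^+ 2 = 6 * sigma ^+ 2 * Lh^-1 * p ^+ 8 * l.
  rewrite [LHS](_ : _ = Num.sqrt 6 ^+ 2 * sigma ^+ 2 * (Num.sqrt Lh ^+ 2)^-1
    * p ^+ 8 * Num.sqrt l ^+ 2); last by rewrite -exprVn /a; ring.
  by rewrite !sqr_sqrtr// ltW.
have b2 : b ^+ 2 = 4 * (C1 * Lh) * p ^+ 8.
  by rewrite !exprMn sqr_sqrtr ?mulr_ge0 ?ltW//; ring.
have c2 : c ^+ 2 = 6 * sigma ^+ 2 * Lh^-1 ^+ 2 * Lf * p ^+ 14 * l.
  rewrite [LHS](_ : _ = sigma ^+ 2 * Lh^-1 ^+ 2 * Num.sqrt (6 * Lf) ^+ 2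
    * p ^+ 14 * Num.sqrt l ^+ 2); last by rewrite /c; ring.
  by rewrite !sqr_sqrtr ?mulr_ge0//; ring.
have d2 : d ^+ 2 = 4 * (C1 * Lf) * p ^+ 14.
  by rewrite !exprMn sqr_sqrtr ?mulr_ge0 ?(ltW C1_gt0)//; ring.
set tau := a + b + 2 * Lam * p ^+ 6 + c + d.
have S0 : 0 < a + b + c + d by rewrite ltr_wpDr// ltr_wpDr// ltr_wpDl.
have tauE : tau = 2 * Lam / p ^- 6 + (a + b + c + d) by rewrite invrK /tau; ring.
exists (p ^- 6).
have MS : (Lf * K ^- 2 + Lh / Num.sqrt K)
    * (C1 + sigma ^+ 2 / (2 * Lh ^+ 2) * l)
    <= p ^- 6 * (a + b + c + d) ^+ 2 / 2.
  apply: (le_trans (ler_wpM2r V0 B)).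
  have h := ler_wpM2l (ltW r0) (sum_sqr_le_sqr_sum a0 (ltW b0) c0 d0).
  rewrite a2 b2 c2 d2 in h.
  rewrite ler_pdivlMr//; apply: le_trans h.
  have X1 : 0 <= sigma ^+ 2 * Lh^-1 * p ^+ 2 * l.
    by rewrite !mulr_ge0 ?sqr_ge0 ?invr_ge0// ltW.
  have X2 : 0 <= C1 * Lh * p ^+ 2 by rewrite !mulr_ge0// ltW.
  have X3 : 0 <= sigma ^+ 2 * Lf * Lh ^- 2 * p ^+ 8 * l.
    by rewrite !mulr_ge0 ?sqr_ge0 ?invr_ge0 ?sqr_ge0// ltW.
  have X4 : 0 <= C1 * Lf * p ^+ 8 by rewrite !mulr_ge0// ltW.
  rewrite -subr_ge0 [X in 0 <= X](_ : _ =
    5 * (sigma ^+ 2 * Lh^-1 * p ^+ 2 * l) + 2 * (C1 * Lh * p ^+ 2)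
    + 5 * (sigma ^+ 2 * Lf * Lh ^- 2 * p ^+ 8 * l) + 2 * (C1 * Lf * p ^+ 8)).
    by lra.
  by field; rewrite !gt_eqF.
have [h1 h2] := quadratic_at_shift r0 Lam0 S0 tauE MS.
by split=> //; rewrite rhoE// powR_three_half ?addr_ge0.
Qed.

End mean.
End bounds.
End rates.

(** * Measurability of vector-valued maps *)

Section measurability.
Context {R : realType} {n : nat} {d : measure_display} {T : measurableType d}.

Definition row_measurable k (v : T -> 'rV[R]_k) :=
  forall j, measurable_fun setT (fun t => v t ord0 j).

(** Both approximation arguments below freeze the value of a vector on the cells
    of a grid, that is, on the fibres of a map with countably many values. *)
Lemma measurable_countable_pasting (I : countType) (K : T -> I)
    (F : I -> T -> R) :
  (forall i, measurable (K @^-1` [set i])) ->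
  (forall i, measurable_fun setT (F i)) ->
  measurable_fun setT (fun t => F (K t) t).
Proof.
move=> mK mF _ B mB; rewrite setTI.
pose A i := K @^-1` [set i] `&` F i @^-1` B.
have mA i : measurable (A i).
  by apply: measurableI => //; rewrite -[X in measurable X]setTI; exact: mF.
rewrite (_ : _ @^-1` B =
    \bigcup_k oapp A set0 (@choice.unpickle I k)).
  by apply: bigcupT_measurable => k; case: (@choice.unpickle I k) => /=.
apply/seteqP; split=> [t Bt|t [k _]].
  by exists (choice.pickle (K t)) => //; rewrite choice.pickleK.
by case: (@choice.unpickle I k) => [i [/= <-]|].
Qed.

Definition grid_key k N (v : 'rV[R]_k) : 'rV[int]_k :=
  \row_j Num.floor (N.+1%:R * v ord0 j).

Definition grid_point k N (key : 'rV[int]_k) : 'rV[R]_k :=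
  \row_j ((key ord0 j)%:~R / N.+1%:R).

Lemma grid_dist k N (v : 'rV[R]_k) j :
  `|v ord0 j - grid_point N (grid_key N v) ord0 j| <= N.+1%:R^-1.
Proof.
rewrite !mxE; set x := v ord0 j; set a := N.+1%:R * x.
have N0 : 0 < N.+1%:R :> R by [].
have /andP[h1 h2] := floor_itv a.
have -> : x - (Num.floor a)%:~R / N.+1%:R = (a - (Num.floor a)%:~R) / N.+1%:R.
  by rewrite /a; field; rewrite gt_eqF.
rewrite ger0_norm.
  rewrite ler_pdivrMr// mulVf ?gt_eqF//.
  by move: h2; rewrite intrD1; lra.
by rewrite divr_ge0// subr_ge0.
Qed.

Lemma measurable_grid_key k N (v : T -> 'rV[R]_k) : row_measurable v ->
  forall key, measurable ((fun t => grid_key N (v t)) @^-1` [set key]).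
Proof.
move=> mv key.
rewrite (_ : _ @^-1` _ = \bigcap_(j in [set: 'I_k])
    ((fun t => N.+1%:R * v t ord0 j) @^-1`
      `[(key ord0 j)%:~R, (key ord0 j + 1)%:~R[%classic)).
  apply: fin_bigcap_measurable => [|j _]; first exact: finite_finset.
  rewrite -[X in measurable X]setTI.
  have : measurable_fun setT (fun t => N.+1%:R * v t ord0 j).
    exact: measurable_funM.
  by apply.
apply/seteqP; split=> [t /= <- j _|t /= h].
  by rewrite /= mxE in_itv/= floor_itv.
apply/rowP => j; rewrite mxE; apply: floor_def.
by have := h j I; rewrite /= in_itv.
Qed.

Lemma cvg_grid_point k (v : 'rV[R]_k) :
  (fun N => grid_point N (grid_key N v)) @ \oo --> v.
Proof.
apply/cvgrPdist_le => e e0.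
have /cvgrPdist_le/(_ e e0) := @cvg_harmonic R.
apply: filterS => N; rewrite sub0r normrN ger0_norm /harmonic ?invr_ge0//= => h.
rewrite [leLHS]/Num.norm/= mx_normrE; apply: bigmax_le; first exact: ltW.
move=> [i j] _ /=; rewrite !mxE [i]ord1; apply: le_trans h.
by have := grid_dist N v j; rewrite !mxE.
Qed.

(** A Caratheodory function composed with a measurable map: on each cell of a
    grid of mesh [N.+1^-1] freeze the first argument at the grid point. *)
Lemma measurable_caratheodory (f : 'rV[R]_n -> T -> R) (v : T -> 'rV[R]_n) :
  row_measurable v ->
  (forall u, measurable_fun setT (f u)) ->
  (forall t, continuous (f^~ t)) ->
  measurable_fun setT (fun t => f (v t) t).
Proof.
move=> mv mf cf.
apply: (measurable_fun_cvg
  (h := fun N t => f (grid_point N (grid_key N (v t))) t)).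
  move=> N; apply: (measurable_countable_pasting
    (K := fun t => grid_key N (v t)) (F := fun key => f (grid_point N key))).
    exact: measurable_grid_key.
  by move=> key; exact: mf.
move=> t _; have c := cvg_comp _ _ (@cvg_grid_point _ (v t)) (cf t (v t)).
exact: c.
Qed.

(** On each grid cell [g] is frozen at its value at some point whose image under
    [v] lies in the cell, if there is one; the error is then at most the diameter
    of a cell. *)
Lemma measurable_lipschitz_lift (g : T -> R) (v : T -> 'rV[R]_n) :
  row_measurable v -> (forall s t, `|g s - g t| <= enorm (v s - v t)) ->
  measurable_fun setT g.
Proof.
move=> mv lip.
pose rep N key : R :=
  if pselect (exists t, grid_key N (v t) = key) is left h then g (projT1 (cid h))
  else 0.
apply: (measurable_fun_cvg (h := fun N t => rep N (grid_key N (v t)))).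
  move=> N; apply: (measurable_countable_pasting
    (K := fun t => grid_key N (v t)) (F := fun key _ => rep N key)) => //.
  exact: measurable_grid_key.
move=> t _; apply/cvgrPdist_le => e e0.
have h N : `|g t - rep N (grid_key N (v t))| <= n%:R * 2 / N.+1%:R.
  rewrite /rep; case: pselect => [h|[]]; last by exists t.
  case: (cid h) => s /= st; apply: (le_trans (lip _ _)).
  apply: (le_trans (enorm_le_sum _)).
  rewrite (_ : n%:R * 2 / N.+1%:R = \sum_(j < n) (2 / N.+1%:R : R)); last first.
    by rewrite sumr_const card_ord -mulrA mulr_natl.
  apply: ler_sum => j _; rewrite !mxE.
  have := grid_dist N (v t) j; have := grid_dist N (v s) j; rewrite st.
  move: (grid_point _ _ _ _) => p h1 h2.
  rewrite (_ : v t ord0 j - v s ord0 j = (v t ord0 j - p) - (v s ord0 j - p)).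
    rewrite (le_trans (ler_normB _ _))//.
    by move: h1 h2; move: (N.+1%:R^-1) => q; lra.
  by ring.
have c0 : (fun N => n%:R * 2 / N.+1%:R : R) @ \oo --> (n%:R * 2 * 0 : R).
  by apply: cvgMr; exact: cvg_harmonic.
move/cvgrPdist_le : c0 => /(_ e e0); apply: filterS => N hN.
apply: (le_trans (h N)); move: hN; rewrite mulr0 sub0r normrN.
by apply: le_trans; exact: ler_norm.
Qed.

End measurability.

Section measurable_vectors.
Context {R : realType} {n : nat} {d : measure_display} {T : measurableType d}.
Implicit Types v w : T -> 'rV[R]_n.

Lemma row_measurable_cst (a : 'rV[R]_n) : row_measurable (fun _ : T => a).
Proof. by move=> j; exact: measurable_cst. Qed.

Lemma row_measurableD v w : row_measurable v -> row_measurable w ->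
  row_measurable (fun t => v t + w t).
Proof.
move=> mv mw j; under eq_fun do rewrite mxE.
exact: measurable_funD.
Qed.

Lemma row_measurableZ a v : row_measurable v ->
  row_measurable (fun t => a *: v t).
Proof.
move=> mv j; under eq_fun do rewrite mxE.
exact: measurable_funM.
Qed.

Lemma row_measurableB v w : row_measurable v -> row_measurable w ->
  row_measurable (fun t => v t - w t).
Proof.
move=> mv mw; under eq_fun do rewrite -scaleN1r.
by apply: row_measurableD => //; exact: row_measurableZ.
Qed.

Lemma measurable_edot v w : row_measurable v -> row_measurable w ->
  measurable_fun setT (fun t => edot (v t) (w t)).
Proof. by move=> mv mw; apply: measurable_sum => i; exact: measurable_funM. Qed.

Lemma measurable_continuous_row (phi : 'rV[R]_n -> R) v : continuous phi ->
  row_measurable v -> measurable_fun setT (phi \o v).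
Proof.
move=> cphi mv.
by apply: (measurable_caratheodory (f := fun u _ => phi u)).
Qed.

Lemma row_measurable_comp d1 (S : measurableType d1) (h : S -> T) v :
  measurable_fun setT h -> row_measurable v -> row_measurable (v \o h).
Proof. by move=> mh mv j; exact: measurableT_comp (mv j) mh. Qed.

End measurable_vectors.

(** * Integrating out an independent sample *)

Section freezing.
Context {R : realType} {d d1 d2 : measure_display} {Omega : measurableType d}
  {U : measurableType d1} {S : measurableType d2} (P : probability Omega R).

Lemma bounded_integrable (f : Omega -> R) (M : R) :
  measurable_fun setT f -> (forall w, `|f w| <= M) ->
  P.-integrable setT (EFin \o f).
Proof.
move=> mf bf; apply: measurable_bounded_integrable => //.
  exact: fin_num_fun_lty.
by exists M; split; rewrite ?num_real// => x Mx y _; exact/(le_trans _ (ltW Mx)).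
Qed.

Lemma integral_probability_cst d0 (T : measurableType d0) (Q : probability T R)
    (r : R) : (\int[Q]_w r%:E = r%:E)%E.
Proof.
rewrite integral_cst// [X in (_ * X)%E](_ : _ = 1%E) ?mule1//.
exact: (probability_setT Q).
Qed.

Variables (u : {mfun Omega >-> U}) (s : {mfun Omega >-> S}).

Let pair w : U * S := (u w, s w).

Let measurable_pair : measurable_fun setT pair.
Proof. exact: measurable_fun_pair. Qed.

HB.instance Definition _ :=
  isMeasurableFun.Build _ _ _ _ pair measurable_pair.

(** When [u] and [s] are independent and [s'] is distributed as [s], the law of
    the pair is a product, so that Fubini's theorem integrates [s] out first,
    with [u] frozen. *)
Lemma integral_independent_le (s' : {mfun Omega >-> S}) (Phi : U * S -> R)
    (M b : R) :
  (forall A B, measurable A -> measurable B ->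
    P (u @^-1` A `&` s @^-1` B) = (distribution P u A * distribution P s B)%E) ->
  (forall B, measurable B -> distribution P s B = distribution P s' B) ->
  measurable_fun setT Phi -> (forall v, `|Phi v| <= M) ->
  (forall a, (\int[P]_w (Phi (a, s' w))%:E <= b%:E)%E) ->
  (\int[P]_w (Phi (u w, s w))%:E <= b%:E)%E.
Proof.
move=> ind law mPhi bPhi hb.
have mEPhi : measurable_fun setT (EFin \o Phi) by exact/measurable_EFinP.
have lawE A : measurable A ->
    distribution P pair A = (distribution P u \x distribution P s)%E A.
  by move=> mA; apply/esym; apply: product_measure_unique.
have iPhi : (distribution P u \x distribution P s)%E.-integrable setT
    (EFin \o Phi).
  apply: measurable_bounded_integrable => //.
    have := lawE setT measurableT; rewrite probability_setT => e.
    by rewrite [X in (X < _)%E](_ : _ = 1%E) ?ltry.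
  by exists M; split; rewrite ?num_real// => x Mx y _; exact/(le_trans _ (ltW Mx)).
have -> : (\int[P]_w (Phi (u w, s w))%:E =
    \int[distribution P u \x distribution P s]_v (EFin \o Phi) v)%E.
  transitivity (\int[distribution P pair]_v (EFin \o Phi) v)%E.
    apply/esym/(integral_distribution mEPhi).
    apply: (@bounded_integrable (Phi \o pair) M); last by move=> w; exact: bPhi.
    exact: measurableT_comp.
  by apply: eq_measure_integral => A mA _; exact: lawE.
rewrite -(integral12_prod_meas1 iPhi).
rewrite -(integral_probability_cst (distribution P u) b); apply: le_integral => //.
- exact: integrable_fubini_F.
- exact: finite_measure_integrable_cst.
move=> a _; rewrite /fubini_F; apply: le_trans (hb a).
have mPhia : measurable_fun setT (fun t => Phi (a, t)).
  by apply: measurableT_comp.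
rewrite le_eqVlt; apply/orP; left; apply/eqP.
transitivity (\int[distribution P s']_t (Phi (a, t))%:E)%E.
  by apply: eq_measure_integral => A mA _; exact: law.
rewrite integral_distribution//; first exact/measurable_EFinP.
apply: (@bounded_integrable (fun w => Phi (a, s' w)) M); last first.
  by move=> w; exact: bPhi.
exact: measurableT_comp mPhia _.
Qed.

End freezing.

Section integral_bounds.
Context {R : realType} {d : measure_display} {T : measurableType d}.
Local Open Scope ereal_scope.

(** The integral of a nonnegative function is a supremum over the simple
    functions below it, hence monotone on arbitrary functions.  In this way the
    objective along the iterates, where [psi] is merely lower semicontinuous, is
    compared directly with measurable bounds. *)
Lemma le_integral_pointwise (mu : {measure set T -> \bar R}) (f g : T -> \bar R) :
  (forall t, f t <= g t) -> \int[mu]_t f t <= \int[mu]_t g t.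
Proof.
move=> fg.
have ge0_le (f' g' : T -> \bar R) : (forall t, 0 <= f' t) ->
    (forall t, 0 <= g' t) -> (forall t, f' t <= g' t) ->
    \int[mu]_t f' t <= \int[mu]_t g' t.
  move=> f0 g0 fg'; rewrite !ge0_integralTE//; apply: ereal_sup_le.
  by move=> _ [h hf <-]; exists h => // t; apply: le_trans (fg' t).
rewrite integralE [leRHS]integralE; apply: leeB; apply: ge0_le => // t.
  by rewrite !funeposE ge_max !le_max lexx (fg t) !orbT.
by rewrite !funenegE ge_max !le_max lexx orbT andbT leeN2 fg.
Qed.

Lemma integral_affine_ge (P : probability T R) (W : T -> R) (a b M : R) :
  (0 <= a)%R -> P.-integrable setT (EFin \o W) -> \int[P]_t (W t)%:E <= M%:E ->
  (b - a * M)%:E <= \int[P]_t (b - a * W t)%:E.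
Proof.
move=> a0 iW WM.
rewrite [leRHS](_ : _ = \int[P]_t (b%:E + (- a)%:E * (W t)%:E)); last first.
  by apply: eq_integral => t _; rewrite -EFinM -EFinD mulNr.
rewrite integralD//; [|exact: finite_measure_integrable_cst|exact: integrableZl].
rewrite integral_probability_cst integralZl// EFinD leeD2lE//.
by rewrite !EFinN mulNe leeN2 EFinM lee_wpmul2l// lee_fin.
Qed.

End integral_bounds.

Section history.
Context {R : realType} {d : measure_display} {Omega : measurableType d}
  (P : probability Omega R) {d' : measure_display} {Xi : measurableType d'}.
Variable X : nat -> {RV P >-> Xi}.

Definition cylinder N (A : nat -> set Xi) : set Omega :=
  \bigcap_(k in [set k | (1 <= k < N)%N]) (X k @^-1` A k).

Definition cylinders N : set (set Omega) :=
  [set C | exists2 A : nat -> set Xi, (forall k, measurable (A k)) &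
           C = cylinder N A].

(** The sample space with the sigma-algebra of the samples of index less than
    [N]. *)
Definition history N := g_sigma_algebraType (cylinders N).

Lemma cylinder_setT N : cylinder N (fun=> setT) = setT.
Proof. by apply/seteqP; split => // w _ k _. Qed.

Lemma cylinders_setI N : setI_closed (cylinders N).
Proof.
move=> _ _ [A mA ->] [B mB ->]; exists (fun k => A k `&` B k).
  by move=> k; exact: measurableI.
by apply/seteqP; split=> [w [hA hB] k kN|w h];
  [split; [exact: hA|exact: hB]|split=> k kN; have [] := h k kN].
Qed.

Lemma measurable_cylinder N A : (forall k, measurable (A k)) ->
  measurable (cylinder N A).
Proof.
move=> mA; apply: fin_bigcap_measurable => [|k _].
  by apply: (@sub_finite_set _ _ `I_N) => [k /= /andP[]|].
exact: measurable_funPTI.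
Qed.

(** The identity map, measurable from the full sigma-algebra to the coarser one;
    its law is the restriction of [P] to the history. *)
Definition to_history N : Omega -> history N := id.

Let measurable_to_history N : measurable_fun setT (to_history N).
Proof.
apply: (@measurability _ _ Omega (history N) _ _ (cylinders N)) => //.
move=> _ [_ [A mA ->] <-].
by rewrite setTI; exact: measurable_cylinder.
Qed.

HB.instance Definition _ N := isMeasurableFun.Build _ _ _ _ (to_history N)
  (@measurable_to_history N).

Lemma measurable_history_mono M N : (M <= N)%N ->
  measurable_fun setT (id : history N -> history M).
Proof.
move=> MN.
apply: (@measurability _ _ (history N) (history M) _ _ (cylinders M)) => //.
move=> _ [_ [A mA ->] <-].
rewrite setTI; apply: sub_sigma_algebra.
exists (fun k => if (k < M)%N then A k else setT).
  by move=> k; case: ifP.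
apply/seteqP; split=> [w h k /andP[k1 kN]|w h k /andP[k1 kM]] /=.
  by case: ifP => // kM; apply: h; rewrite /= k1.
by have := h k; rewrite /= k1 kM (leq_trans kM MN); exact.
Qed.

Lemma measurable_history_sample N k : (1 <= k < N)%N ->
  measurable_fun setT (X k : history N -> Xi).
Proof.
move=> kN _ B mB; rewrite setTI; apply: sub_sigma_algebra.
exists (fun i => if i == k then B else setT).
  by move=> i; case: ifP.
apply/seteqP; split=> [w h i iN /=|w h].
  by case: eqP => // ->.
by have := h k kN; rewrite /= eqxx.
Qed.

Variable xi : {RV P >-> Xi}.
Hypothesis iid : iid_copies [set k | (1 <= k)%N] xi X.

Let index_range N : {fset nat} := [fset k in iota 1 N.-1]%fset.

Let index_rangeE N k : (k \in index_range N) = (1 <= k < N)%N.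
Proof. by rewrite !inE /= mem_iota add1n; case: N => [|N]; case: k. Qed.

Lemma independent_cylinder N (A : nat -> set Xi) (B : set Xi) : (1 <= N)%N ->
  (forall k, measurable (A k)) -> measurable B ->
  P (cylinder N A `&` X N @^-1` B) = (P (cylinder N A) * P (X N @^-1` B))%E.
Proof.
move=> N1 mA mB; have [mind _] := iid.
have cylE (M : nat) A' : cylinder M A' =
    \bigcap_(k in [set` index_range M]) (X k @^-1` A' k).
  rewrite /cylinder; congr (bigcap _ _).
  by apply/seteqP; split=> k /=; rewrite index_rangeE.
have sub M : [set` index_range M] `<=` [set k | (1 <= k)%N].
  by move=> k /=; rewrite index_rangeE => /andP[].
have E1 := mind _ _ (sub N) mA.
pose A' k := if k == N then B else A k.
have mA' k : measurable (A' k) by rewrite /A'; case: ifP.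
have E2 := mind _ _ (sub N.+1) mA'.
rewrite -!cylE in E1 E2.
have -> : cylinder N A `&` X N @^-1` B = cylinder N.+1 A'.
  apply/seteqP; split=> [w [h hB] k /= /andP[k1]|w h].
    rewrite ltnS leq_eqVlt /A' => /predU1P[->|kN]; first by rewrite eqxx.
    by rewrite ltn_eqF//; apply: h; rewrite /= k1.
  split=> [k /= /andP[k1 kN]|].
    by have := h k; rewrite /A' /= k1 (ltn_eqF kN) (leqW kN); exact.
  by have := h N; rewrite /A' /= eqxx N1 ltnSn; exact.
rewrite E1 E2 (big_fsetD1 N)/=; last by rewrite index_rangeE N1 ltnSn.
rewrite /A' eqxx muleC; congr (_ * _)%E.
rewrite (_ : (index_range N.+1 `\ N)%fset = index_range N).
  by apply: eq_big_seq => k; rewrite index_rangeE => /andP[_ /ltn_eqF ->].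
apply/fsetP => k; rewrite in_fsetD1 !index_rangeE ltnS [(k <= N)%N]leq_eqVlt.
by case: (ltngtP k N) => //=; rewrite ?andbF ?andbT.
Qed.

(** Uniqueness of measures: both sides are finite measures in [A] that agree on
    the cylinders, a generating family closed under intersection. *)
Lemma independent_history N (A : set (history N)) (B : set Xi) : (1 <= N)%N ->
  measurable A -> measurable B ->
  P (to_history N @^-1` A `&` X N @^-1` B)
  = (distribution P (to_history N) A * distribution P (X N) B)%E.
Proof.
move=> N1 mA mB.
have mXB : measurable (X N @^-1` B) by exact: measurable_funPTI.
pose m1 : {measure set (history N) -> \bar R} :=
  pushforward (mrestr P mXB) (to_history N).
have p0 : 0 <= fine (P (X N @^-1` B)) by rewrite fine_ge0.
pose m2 : {measure set (history N) -> \bar R} :=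
  mscale (NngNum p0) (distribution P (to_history N)).
have pE : (fine (P (X N @^-1` B)))%:E = P (X N @^-1` B).
  by rewrite fineK// fin_num_measure.
have m2E C : m2 C = (distribution P (to_history N) C
    * distribution P (X N) B)%E by rewrite -[X in (_ * X)%E]pE muleC.
rewrite -m2E; apply: (@measure_unique _ R (history N) (cylinders N)
  (fun=> setT) erefl (@cylinders_setI N) _ _ (m1 (@measurable_to_history N)) m2
  _ _ A mA).
- by move=> _; exists (fun=> setT) => //; rewrite cylinder_setT.
- by rewrite bigcup_const//; exists 0%N.
- by move=> _ [C mC ->]; rewrite m2E; exact: independent_cylinder.
- move=> _; apply: (le_lt_trans (probability_le1 P _)); last exact: ltry.
  by rewrite preimage_setT setTI.
Qed.

(** The form in which independence is used: the iterates depend on the history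
    only, so a bound with frozen iterates and a generic sample carries over to
    the sample that is drawn at iteration [N]. *)
Lemma integral_fresh_sample N (Phi : history N * Xi -> R) (M b : R) :
  (1 <= N)%N -> measurable_fun setT Phi -> (forall u, `|Phi u| <= M) ->
  (forall w, (\int[P]_w' (Phi (w, xi w'))%:E <= b%:E)%E) ->
  (\int[P]_w (Phi (to_history N w, X N w))%:E <= b%:E)%E.
Proof.
move=> N1 mPhi bPhi hb.
apply: (@integral_independent_le R _ _ _ Omega (history N) Xi P (to_history N)
  (X N) xi Phi M b) => //.
- by move=> A B mA mB; exact: independent_history.
- exact: iid.2.
Qed.

End history.

(** * Moments of the sampled gradient *)

Section oracle.
Context {R : realType} {n m : nat}
  {d : measure_display} {Omega : measurableType d} (P : probability Omega R)
  {d' : measure_display} {Xi : measurableType d'} (xi : {RV P >-> Xi}).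
Variables (ftilde : 'rV[R]_n -> Xi -> R) (psi : 'rV[R]_n -> \bar R)
  (c : 'rV[R]_n -> 'rV[R]_m).
Hypothesis csp : convex_stochastic_problem xi ftilde psi c.

Local Notation f := (fmean xi ftilde).

Lemma fmeanE u : (\int[P]_w (ftilde u (xi w))%:E)%E = (f u)%:E.
Proof.
rewrite /fmean unlock fineK//.
exact: integrable_fin_num (csp_integrable csp u).
Qed.

Lemma fmean_convex : convex_on_space f.
Proof.
move=> t x y _ _; have iF u := csp_integrable csp u.
rewrite -lee_fin -fmeanE.
rewrite [leRHS](_ : _ = \int[P]_w (t%:inum%:E * (ftilde x (xi w))%:E
    + (1 - t%:inum)%:E * (ftilde y (xi w))%:E))%E.
  apply: le_integral => //; first exact: iF.
    by apply: integrableD => //; apply: integrableZl => //; exact: iF.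
  move=> w _; rewrite -!EFinM -EFinD lee_fin.
  by have := csp_f_convex csp (xi w) t (mem_set I : x \in setT)
    (mem_set I : y \in setT).
rewrite integralD//; [|by apply: integrableZl => //; exact: iF..].
by rewrite !integralZl//; [|exact: iF..]; rewrite !fmeanE.
Qed.

Lemma measurable_gradf u j :
  measurable_fun setT (fun s => gradf ftilde u s ord0 j).
Proof.
apply: (measurable_fun_cvg (h := fun k s => k.+1%:R *
    (ftilde (k.+1%:R^-1 *: delta_mx ord0 j + u) s - ftilde u s))).
  move=> k; apply: measurable_funM => //; apply: measurable_funB;
    exact: csp_measurable csp _.
move=> s _; rewrite /gradf.
have [dif _] := csp_f_C1 csp s.
have := @cvg_difference_quotient _ _ (ftilde^~ s) u (delta_mx ord0 j) (dif u).
by rewrite edot_gradE// /grad mxE.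
Qed.

Lemma continuous_gradf s j : continuous (fun u => gradf ftilde u s ord0 j).
Proof.
have [_ cg] := csp_f_C1 csp s => u.
apply: (@continuous_comp _ _ _ (fun u => gradf ftilde u s)
  (fun M : 'rV[R]_n => M ord0 j)); first exact: cg.
exact: coord_continuous.
Qed.

Variables (Lgf sigma G : R).
Hypothesis HB : assumptionB xi ftilde psi Lgf sigma G.

Lemma measurable_gradf_xi u j :
  measurable_fun setT (fun w => gradf ftilde u (xi w) ord0 j).
Proof. exact: measurableT_comp (measurable_gradf u j) _. Qed.

Lemma integrable_gradf_xi u j : edom psi u ->
  P.-integrable setT (fun w => (gradf ftilde u (xi w) ord0 j)%:E).
Proof.
move=> uX; apply: (@bounded_integrable _ _ _ P _ G).
  exact: measurable_gradf_xi.
by move=> w; apply: (le_trans (normr_coord_le _ _)); exact: B_bounded HB _ _ uX.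
Qed.

Lemma mean_edot_gradf u v : edom psi u ->
  (\int[P]_w (edot (gradf ftilde u (xi w)) v)%:E)%E = (edot (grad f u) v)%:E.
Proof.
move=> uX; under eq_integral do rewrite /edot -sumEFin.
rewrite integral_sum//; last first.
  move=> i; under eq_fun do rewrite EFinM.
  by apply: integrableZr => //; exact: integrable_gradf_xi.
rewrite -sumEFin; apply: eq_bigr => i _.
under eq_integral do rewrite EFinM.
rewrite integralZr//; last exact: integrable_gradf_xi.
by have := B_unbiased HB uX i; rewrite unlock => ->.
Qed.

Lemma integrable_edot_gradf u v : edom psi u ->
  P.-integrable setT (fun w => (edot (gradf ftilde u (xi w)) v)%:E).
Proof.
move=> uX; apply: (@bounded_integrable _ _ _ P _ (G * enorm v)).
  apply: measurable_sum => i; apply: measurable_funM => //.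
  exact: measurable_gradf_xi.
move=> w; apply: (le_trans (normr_edot_le _ _)).
by rewrite ler_wpM2r ?enorm_ge0//; exact: B_bounded HB _ _ uX.
Qed.

(** The squared norm of the mean gradient is the mean of its inner product with
    the sampled gradients, each at most [G] times its norm. *)
Lemma enorm_grad_mean u : edom psi u -> enorm (grad f u) <= G.
Proof.
move=> uX; set g := grad f u.
have : (\int[P]_w (edot (gradf ftilde u (xi w)) g)%:E
        <= \int[P]_w (G * enorm g)%:E)%E.
  apply: le_integral => //; first exact: integrable_edot_gradf.
    exact: finite_measure_integrable_cst.
  move=> w _; rewrite lee_fin (le_trans (edot_le _ _))//.
  by rewrite ler_wpM2r ?enorm_ge0//; exact: B_bounded HB _ _ uX.
rewrite mean_edot_gradf// integral_probability_cst lee_fin.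
rewrite -sqr_enorm expr2 => h.
have [->|g0] := eqVneq (enorm g) 0; first exact: ltW (B_G_gt0 HB).
by rewrite -(ler_pM2r (_ : 0 < enorm g))// lt_neqAle eq_sym g0 enorm_ge0.
Qed.

Lemma enorm_noise u s : edom psi u ->
  enorm (gradf ftilde u s - grad f u) <= 2 * G.
Proof.
move=> uX; apply: (le_trans (enormD _ _)); rewrite enormN.
have := B_bounded HB s uX; have := enorm_grad_mean uX; lra.
Qed.

(** The linear part of the noise averages out, the quadratic part is a
    variance. *)
Lemma mean_noise_le u v (a b : R) : edom psi u -> 0 <= a ->
  (\int[P]_w (a * enorm (gradf ftilde u (xi w) - grad f u) ^+ 2
     - b * edot (gradf ftilde u (xi w) - grad f u) v)%:E
   <= (a * sigma ^+ 2)%:E)%E.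
Proof.
move=> uX a0; set g := grad f u.
pose V w := enorm (gradf ftilde u (xi w) - g) ^+ 2.
have mV : measurable_fun setT V.
  rewrite (_ : V = fun w => edot (gradf ftilde u (xi w) - g)
    (gradf ftilde u (xi w) - g)); last by apply/funext => w; rewrite /V sqr_enorm.
  apply: measurable_sum => i.
  have mi : measurable_fun setT (fun w => (gradf ftilde u (xi w) - g) ord0 i).
    rewrite (_ : (fun w => _) =
      fun w => gradf ftilde u (xi w) ord0 i - g ord0 i).
      by apply: measurable_funB => //; exact: measurable_gradf_xi.
    by apply/funext => w; rewrite mxE [X in _ + X]mxE.
  exact: measurable_funM.
have iV : P.-integrable setT (EFin \o V).
  apply: (@bounded_integrable _ _ _ P _ ((2 * G) ^+ 2)) => // w.
  have G0 := B_G_gt0 HB.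
  rewrite ger0_norm ?sqr_ge0// ler_sqr ?nnegrE ?enorm_ge0//; last by lra.
  exact: enorm_noise.
have iE := integrable_edot_gradf v uX.
rewrite [leLHS](_ : _ = \int[P]_w (a%:E * (V w)%:E
  + ((- b)%:E * (edot (gradf ftilde u (xi w)) v)%:E + (b * edot g v)%:E)))%E;
  last first.
  apply: eq_integral => w _; rewrite -!EFinM -!EFinD; congr EFin.
  by rewrite -/(V w) edotDl edotNl; ring.
rewrite integralD//; [|exact: integrableZl|]; last first.
  apply: integrableD => //; first exact: integrableZl.
  exact: finite_measure_integrable_cst.
rewrite integralD//; [|exact: integrableZl|]; last first.
  exact: finite_measure_integrable_cst.
rewrite !integralZl// mean_edot_gradf// integral_probability_cst.
rewrite -EFinM -EFinD mulNr addNr adde0.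
rewrite EFinM lee_wpmul2l//.
by have := B_variance HB uX; rewrite unlock.
Qed.

End oracle.

(** * One sample path *)

Section sample_path.
Context {R : realType} {n m : nat}
  {d : measure_display} {Omega : measurableType d} (P : probability Omega R)
  {d' : measure_display} {Xi : measurableType d'} (xi : {RV P >-> Xi}).
Variables (ftilde : 'rV[R]_n -> Xi -> R) (psi : 'rV[R]_n -> \bar R)
  (c : 'rV[R]_n -> 'rV[R]_m).
Variables (Fstar DX DF : R) (Lc Lgc Cb : 'I_m -> R) (Lambda Lgf sigma G : R)
  (beta gamma rho : nat -> R) (x1 : 'rV[R]_n).

Local Notation f := (fmean xi ftilde).
Local Notation Lgc2 := (\sum_(i < m) (Lc i ^+ 2 + Cb i * Lgc i)).
Local Notation L := (fun k => Lgf + rho k * Lgc2).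

Hypotheses (csp : convex_stochastic_problem xi ftilde psi c)
  (HA : assumptionA xi ftilde psi c Fstar DX DF Lc Lgc Cb Lambda)
  (Lgc2_gt0 : 0 < Lgc2)
  (HB : assumptionB xi ftilde psi Lgf sigma G)
  (rhoE : forall k, (1 <= k)%N -> rho k = (k%:R + 4) `^ (3 / 2))
  (betaE : forall k, (1 <= k)%N -> beta k = (k%:R + 4) / 5)
  (gammaE : forall k, (1 <= k)%N ->
     gamma k = (k%:R + 4) / (10 * (Lgf + rho k * Lgc2))).

Lemma Lgf_ge0 : 0 <= Lgf.
Proof. by have [] := B_f_smooth HB. Qed.

Lemma Lambda_ge0 : 0 <= Lambda.
Proof.
have [[lam _ /= e] _] := A_Lambda HA.
by case: e => <-; exact: enorm_ge0.
Qed.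

Lemma gamma_gt0 k : (1 <= k)%N -> 0 < gamma k.
Proof.
move=> k1; rewrite gammaE// divr_gt0 ?ltr_wpDl// mulr_gt0//.
exact: (L_gt0 Lgf_ge0 Lgc2_gt0 rhoE).
Qed.

Definition gap v := f v + fine (psi v) - Fstar.
Definition violation v := enorm (pospart (c v)).

Lemma objectiveE v : edom psi v ->
  objective xi ftilde psi v = (f v + fine (psi v))%:E.
Proof. by move=> vX; rewrite /objective {1}(edomE (csp_psi_proper csp) vX). Qed.

(** Weak duality for a multiplier of least norm. *)
Lemma gap_ge v : edom psi v -> - Lambda * violation v <= gap v.
Proof.
move=> vX; have [[lam [lam0 [_ lb]] /= [<-]] _] := A_Lambda HA.
have := lb _ (ex_intro2 _ _ v I erefl); rewrite objectiveE// -EFinD lee_fin => h.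
have : edot lam (c v) <= enorm lam * violation v.
  apply: le_trans (edot_le _ _); apply: ler_sum => i _.
  by rewrite mxE ler_wpM2l// le_max lexx.
by rewrite /gap; lra.
Qed.

Lemma optimal_point : is_optimal_value xi ftilde psi c Fstar ->
  exists u, [/\ feasible c u, edom psi u & f u + fine (psi u) = Fstar].
Proof.
move=> [[u fu uF] _]; exists u.
have uX : edom psi u.
  by rewrite /edom/= ltNge leye_eq; apply/negP => /eqP e; move: uF;
    rewrite /objective e.
by split=> //; move: uF; rewrite objectiveE// => -[].
Qed.

Variables (s : nat -> Xi) (x y z : nat -> 'rV[R]_n) (u : 'rV[R]_n).
Hypotheses (run : algorithm_run ftilde psi c beta gamma rho x1 s x y z)
  (fu : feasible c u) (uX : edom psi u) (uF : f u + fine (psi u) = Fstar).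

Lemma beta01 k : (1 <= k)%N -> 0 <= (beta k)^-1 <= 1.
Proof.
move=> k1; have b1 := beta_ge1 betaE k1.
have b0 : 0 < beta k by apply: lt_le_trans b1.
by rewrite invr_ge0 (ltW b0)/= invf_le1.
Qed.

Lemma run_edom k : (1 <= k)%N -> [/\ edom psi (x k), edom psi (y k) &
  edom psi (z k)].
Proof.
have cX := edom_convex (csp_psi_proper csp) (csp_psi_convex csp).
have zX i : (1 <= i)%N -> edom psi (z i.+1).
  move=> i1; exact: (is_prox_edom (csp_psi_proper csp) (gamma_gt0 i1)
    (run_z run i1) uX).
have xzX : (1 <= k)%N -> edom psi (x k) /\ edom psi (z k).
  elim: k => [//|[_ _|k /(_ isT)[xX _] _]].
    by rewrite (run_x1 run) (run_z1 run); have := run_x1_dom run.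
  split; last exact: zX.
  by rewrite (run_x run)//; apply: cX => //; [exact: zX|exact: beta01].
move=> k1; have [xX zkX] := xzX k1; split=> //.
by rewrite (run_y run)//; apply: cX => //; exact: beta01.
Qed.

Definition noise k := gradf ftilde (y k) (s k) - grad f (y k).

Lemma iteration_inequality k : (1 <= k)%N ->
  gap (x k.+1) + rho k * (violation (x k.+1) ^+ 2 / 2) <=
    (1 - (beta k)^-1) * (gap (x k) + rho k * (violation (x k) ^+ 2 / 2))
    + L k * (beta k)^-1 ^+ 2
      * (enorm (z k - u) ^+ 2 - enorm (z k.+1 - u) ^+ 2)
    - (beta k)^-1 * edot (noise k) (z k.+1 - u)
    - L k / 2 * (beta k)^-1 ^+ 2 * enorm (z k.+1 - z k) ^+ 2.
Proof.
move=> k1.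
have pr := csp_psi_proper csp; have cv := csp_psi_convex csp.
have cX := edom_convex pr cv.
have [xX yX zX] := run_edom k1.
have [x'X _ z'X] := run_edom (isT : (1 <= k.+1)%N).
have [_ fdif flip] := B_f_smooth HB.
have fsub a b : edom psi a -> edom psi b -> f b + edot (grad f b) (a - b) <= f a.
  by move=> aX bX; apply: convex_gradient_ineq (fdif b bX); exact: fmean_convex csp.
have csub a : penalty c (y k) + edot (penalty_grad c (y k)) (a - y k)
    <= penalty c a.
  apply: penalty_subgradient => i; first exact: csp_c_convex csp i.
  by have [dif _] := csp_c_C1 csp i; exact: dif.
have r0 := rho_gt0 rhoE k1; have L0 := L_gt0 Lgf_ge0 Lgc2_gt0 rhoE k1.
have := @accelerated_step R n (beta k) (gamma k) (rho k) Lgf Lgc2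
  (x k) (y k) (z k) (z k.+1) (x k.+1) u (beta_ge1 betaE k1)
  (run_y run k1) (run_x run k1) f (fine \o psi) (penalty c)
  (grad f (y k)) (penalty_grad c (y k)) (gradf ftilde (y k) (s k))
  (ltW r0) (gamma_gt0 k1).
have bg : beta k = 2 * (Lgf + rho k * Lgc2) * gamma k.
  by rewrite betaE// gammaE//; field; rewrite gt_eqF.
move=> /(_ bg) h.
have {}h := h (fun w hw => fsub w (y k) ltac:(by case: hw => ->) yX)
  (descent_lemma cX fsub flip x'X yX) (fun w _ => csub w)
  (penalty_descent cX (csp_c_convex csp) (A_c_lipschitz HA) (A_c_smooth HA)
    (A_c_bounded HA) x'X yX) (penalty_feasible fu) _
  (prox_subgradient pr cv (gamma_gt0 k1) (run_z run k1) uX).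
have {h} := h ltac:(by rewrite (run_x run k1); apply: fine_econvex;
  rewrite ?beta01).
rewrite /= uF /gap /violation /penalty /noise.
lra.
Qed.

(** The noise term is at most [2 * G * DX / beta k] by the Cauchy-Schwarz
    inequality; the spare quadratic term is dropped. *)
Lemma deterministic_potential j : (1 <= j)%N ->
  step_weight Lgf Lgc2 rho j *
    (gap (x j.+1) + rho j * (violation (x j.+1) ^+ 2 / 2)) <=
  25 * DX ^+ 2 + 10 * Lambda ^+ 2 / Lgc2
  + 10 * (2 * G * DX) / Lgc2 * Num.sqrt (j%:R + 4).
Proof.
move=> j1; have L0 := L_gt0 Lgf_ge0 Lgc2_gt0 rhoE.
have := @potential_bound _ Lgf Lgc2 Lambda rho beta Lgf_ge0 Lgc2_gt0 Lambda_ge0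
  rhoE betaE (gap \o x) (violation \o x) (fun k => enorm (z k - u) ^+ 2)
  (fun k => (beta k)^-1 * (2 * G * DX)) (fun k _ => sqr_ge0 _) _ _ j j1.
have GD : 0 <= 2 * G * DX.
  by rewrite !mulr_ge0// ltW ?(B_G_gt0 HB) ?(A_DX_gt0 HA).
have := sum_bounded_noise Lgf_ge0 Lgc2_gt0 rhoE betaE j1 GD.
have [_ _ z1X] := run_edom (leqnn 1).
have D1 : enorm (z 1 - u) ^+ 2 <= DX ^+ 2.
  rewrite ler_sqr ?nnegrE ?enorm_ge0 ?(ltW (A_DX_gt0 HA))//.
  exact: (A_diameter HA).
move=> h1 h2; apply: le_trans (h2 _ _) _; last by lra.
  by move=> k k1; apply: gap_ge; have [] := run_edom k1.
move=> k k1; apply: (le_trans (iteration_inequality k1)).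
have [xX yX zX] := run_edom k1.
have [x'X _ z'X] := run_edom (isT : (1 <= k.+1)%N).
have /andP[b0 _] := beta01 k1.
have n1 : - edot (noise k) (z k.+1 - u) <= 2 * G * DX.
  rewrite -edotNl (le_trans (edot_le _ _))// enormN ler_pM ?enorm_ge0//.
    exact: (enorm_noise csp HB (s k) yX).
  exact: (A_diameter HA).
have n2 := ler_wpM2l b0 n1.
have n3 : 0 <= (Lgf + rho k * Lgc2) / 2 * (beta k)^-1 ^+ 2
    * enorm (z k.+1 - z k) ^+ 2.
  by rewrite mulr_ge0 ?sqr_ge0// mulr_ge0 ?sqr_ge0// divr_ge0// ltW ?L0.
rewrite /=; lra.
Qed.

(** What remains of the noise of iteration [k] after the spare quadratic term is
    used: [z k] replaces [z k.+1] in the inner product, so that the linear part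
    is an inner product of the noise with a function of the earlier samples. *)
Definition iteration_noise k := (2 * L k)^-1 * enorm (noise k) ^+ 2
  - (beta k)^-1 * edot (noise k) (z k - u).

Lemma stochastic_potential j : (1 <= j)%N ->
  step_weight Lgf Lgc2 rho j *
    (gap (x j.+1) + rho j * (violation (x j.+1) ^+ 2 / 2)) <=
  25 * DX ^+ 2 + 10 * Lambda ^+ 2 / Lgc2
  + \sum_(1 <= k < j.+1) step_weight Lgf Lgc2 rho k * iteration_noise k.
Proof.
move=> j1; have L0 := L_gt0 Lgf_ge0 Lgc2_gt0 rhoE.
have := @potential_bound _ Lgf Lgc2 Lambda rho beta Lgf_ge0 Lgc2_gt0 Lambda_ge0
  rhoE betaE (gap \o x) (violation \o x) (fun k => enorm (z k - u) ^+ 2)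
  iteration_noise (fun k _ => sqr_ge0 _) _ _ j j1.
have [_ _ z1X] := run_edom (leqnn 1).
have D1 : enorm (z 1 - u) ^+ 2 <= DX ^+ 2.
  rewrite ler_sqr ?nnegrE ?enorm_ge0 ?(ltW (A_DX_gt0 HA))//.
  exact: (A_diameter HA).
move=> h2; apply: le_trans (h2 _ _) _; last by lra.
  by move=> k k1; apply: gap_ge; have [] := run_edom k1.
move=> k k1; apply: (le_trans (iteration_inequality k1)).
have /andP[b0 _] := beta01 k1; have Lk := L0 k k1.
rewrite /iteration_noise /=.
have -> : z k.+1 - u = (z k.+1 - z k) + (z k - u).
  by apply/rowP => i; rewrite !mxE; ring.
(* Young's inequality, weighted so as to use up the spare quadratic term *)
have young (N w : 'rV[R]_n) : - (beta k)^-1 * edot N w <=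
    (2 * (Lgf + rho k * Lgc2))^-1 * enorm N ^+ 2
    + (Lgf + rho k * Lgc2) / 2 * (beta k)^-1 ^+ 2 * enorm w ^+ 2.
  have sq := edot_ge0 (N + ((Lgf + rho k * Lgc2) * (beta k)^-1) *: w).
  have i0 : 0 <= (2 * (Lgf + rho k * Lgc2))^-1.
    by rewrite invr_ge0 mulr_ge0 ?(ltW Lk).
  have := mulr_ge0 i0 sq; rewrite !edotE (edotC w) sqr_enorm sqr_enorm.
  rewrite [X in 0 <= X -> _](_ : _ =
    (2 * (Lgf + rho k * Lgc2))^-1 * edot N N
    + (beta k)^-1 * edot N w
    + (Lgf + rho k * Lgc2) / 2 * (beta k)^-1 ^+ 2 * edot w w).
    by lra.
  by move: (beta k)^-1 => b; field; rewrite gt_eqF.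
rewrite [edot (noise k) (_ + (z k - u))]edotDr.
move: (young (noise k) (z k.+1 - z k)); lra.
Qed.

End sample_path.

(** * The iterates as random variables *)

Section iterates.
Context {R : realType} {n m : nat}
  {d : measure_display} {Omega : measurableType d} (P : probability Omega R)
  {d' : measure_display} {Xi : measurableType d'} (xi : {RV P >-> Xi}).
Variables (ftilde : 'rV[R]_n -> Xi -> R) (psi : 'rV[R]_n -> \bar R)
  (c : 'rV[R]_n -> 'rV[R]_m).
Variables (Fstar DX DF : R) (Lc Lgc Cb : 'I_m -> R) (Lambda Lgf sigma G : R)
  (beta gamma rho : nat -> R) (x1 : 'rV[R]_n) (samples : nat -> {RV P >-> Xi})
  (x y z : nat -> Omega -> 'rV[R]_n).

Local Notation f := (fmean xi ftilde).
Local Notation Lgc2 := (\sum_(i < m) (Lc i ^+ 2 + Cb i * Lgc i)).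
Local Notation L := (fun k => Lgf + rho k * Lgc2).

Hypotheses (csp : convex_stochastic_problem xi ftilde psi c)
  (HA : assumptionA xi ftilde psi c Fstar DX DF Lc Lgc Cb Lambda)
  (Lgc2_gt0 : 0 < Lgc2)
  (HB : assumptionB xi ftilde psi Lgf sigma G)
  (rhoE : forall k, (1 <= k)%N -> rho k = (k%:R + 4) `^ (3 / 2))
  (betaE : forall k, (1 <= k)%N -> beta k = (k%:R + 4) / 5)
  (gammaE : forall k, (1 <= k)%N ->
     gamma k = (k%:R + 4) / (10 * (Lgf + rho k * Lgc2)))
  (iid : iid_copies [set k | (1 <= k)%N] xi samples)
  (run : forall w, algorithm_run ftilde psi c beta gamma rho x1
     (samples ^~ w) (x ^~ w) (y ^~ w) (z ^~ w)).

Lemma measurable_oracle d1 (T : measurableType d1) (v : T -> 'rV[R]_n)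
    (s : T -> Xi) : row_measurable v -> measurable_fun setT s ->
  row_measurable (fun t => gradf ftilde (v t) (s t)).
Proof.
move=> mv ms j.
apply: (measurable_caratheodory
  (f := fun u t => gradf ftilde u (s t) ord0 j)) => //.
  by move=> u; exact: measurableT_comp (measurable_gradf csp u j) ms.
by move=> t; exact: continuous_gradf csp _ _.
Qed.

Lemma measurable_penalty_grad d1 (T : measurableType d1) (v : T -> 'rV[R]_n) :
  row_measurable v -> row_measurable (fun t => penalty_grad c (v t)).
Proof.
move=> mv j; under eq_fun do rewrite summxE.
apply: measurable_sum => i; under eq_fun do rewrite mxE mxE.
have [dif cg] := csp_c_C1 csp i.
apply: measurable_funM.
  apply: measurable_maxr => //.
  apply: (measurable_continuous_row (phi := component c i)) => // a.
  exact: differentiable_continuous (dif a).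
apply: (measurable_continuous_row (phi := fun a => grad (component c i) a ord0 j))
  => // a.
apply: (@continuous_comp _ _ _ (grad (component c i))
  (fun M : 'rV[R]_n => M ord0 j)); first exact: cg.
exact: coord_continuous.
Qed.

Lemma measurable_prox_step d1 (T : measurableType d1) (a : R)
    (v p : T -> 'rV[R]_n) : 0 < a -> row_measurable v ->
  (forall t, is_prox a psi (v t) (p t)) -> row_measurable p.
Proof.
move=> a0 mv prox j; apply: (measurable_lipschitz_lift mv) => s t.
have := normr_coord_le (p s - p t) j; rewrite mxE [X in _ + X]mxE.
move=> /le_trans; apply.
exact: (prox_nonexpansive (csp_psi_proper csp) (csp_psi_convex csp) a0
  (prox s) (prox t)).
Qed.

Local Notation history := (history samples).

(** The vectors [x k] and [z k] are functions of the samples of index less than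
    [k]; the sample of index [k] enters through [z k.+1]. *)
Lemma iterates_adapted k : (1 <= k)%N ->
  row_measurable (x k : history k -> 'rV[R]_n) /\
  row_measurable (z k : history k -> 'rV[R]_n).
Proof.
elim: k => [//|[_ _|k /(_ isT)[mx mz] _]].
  have -> : x 1 = fun=> x1 by apply/funext => w; exact: run_x1 (run w).
  have -> : z 1 = fun=> x1 by apply/funext => w; exact: run_z1 (run w).
  by split; exact: row_measurable_cst.
have mono := @measurable_history_mono _ _ _ _ _ _ samples _ _ (leqnSn k.+1).
have {}mx := row_measurable_comp mono mx.
have {}mz := row_measurable_comp mono mz.
have my : row_measurable (y k.+1 : history k.+2 -> 'rV[R]_n).
  have -> : y k.+1 = fun w => (1 - (beta k.+1)^-1) *: x k.+1 w
      + (beta k.+1)^-1 *: z k.+1 w.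
    by apply/funext => w; apply: (run_y (run w)).
  by apply: row_measurableD; exact: row_measurableZ.
have mz' : row_measurable (z k.+2 : history k.+2 -> 'rV[R]_n).
  apply: (@measurable_prox_step _ (history k.+2) (gamma k.+1)
    (fun w => z k.+1 w - gamma k.+1 *: stoch_grad ftilde c (rho k.+1) (y k.+1 w)
       (samples k.+1 w))); first exact: (gamma_gt0 Lgc2_gt0 HB rhoE gammaE).
    apply: row_measurableB => //; apply: row_measurableZ.
    apply: row_measurableD; last first.
      by apply: row_measurableZ; exact: measurable_penalty_grad.
    apply: measurable_oracle => //.
    by apply: measurable_history_sample; rewrite ltnSn.
  by move=> w; apply: (run_z (run w)).
split=> //.
have -> : x k.+2 = fun w => (1 - (beta k.+1)^-1) *: x k.+1 w
    + (beta k.+1)^-1 *: z k.+2 w.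
  by apply/funext => w; apply: (run_x (run w)).
by apply: row_measurableD; exact: row_measurableZ.
Qed.

Lemma extrapolation_adapted k : (1 <= k)%N ->
  row_measurable (y k : history k -> 'rV[R]_n).
Proof.
move=> k1; have [mx mz] := iterates_adapted k1.
have -> : y k = fun w => (1 - (beta k)^-1) *: x k w + (beta k)^-1 *: z k w.
  by apply/funext => w; apply: (run_y (run w)).
by apply: row_measurableD; exact: row_measurableZ.
Qed.

Variable u : 'rV[R]_n.
Hypotheses (fu : feasible c u) (uX : edom psi u)
  (uF : f u + fine (psi u) = Fstar).

Definition path_noise k w := iteration_noise xi ftilde Lc Lgc Cb Lgf beta rho
  (samples ^~ w) (y ^~ w) (z ^~ w) u k.

Lemma iterates_edom k w : (1 <= k)%N ->
  [/\ edom psi (x k w), edom psi (y k w) & edom psi (z k w)].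
Proof.
move=> k1.
exact: (run_edom csp Lgc2_gt0 HB rhoE betaE gammaE (run w) uX k1).
Qed.

(** Evaluated at the current sample this is [path_noise k]; independence is
    applied to it as a function of a history and of a separate sample. *)
Let frozen_noise k (ws : history k * Xi) : R :=
  let delta := gradf ftilde (y k ws.1) ws.2 - grad f (y k ws.1) in
  (2 * L k)^-1 * enorm delta ^+ 2 - (beta k)^-1 * edot delta (z k ws.1 - u).

Let measurable_frozen_noise k : (1 <= k)%N ->
  measurable_fun setT (frozen_noise (k := k)).
Proof.
move=> k1; have [_ mz] := iterates_adapted k1.
have my := extrapolation_adapted k1.
have mfst : measurable_fun setT (fst : history k * Xi -> history k).
  exact: measurable_fst.
have my1 := row_measurable_comp mfst my.
have mgf : row_measurable (fun ws : history k * Xi => grad f (y k ws.1)).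
  move=> j; have [_ _ lip] := B_f_smooth HB.
  apply: (measurable_lipschitz_lift (row_measurableZ Lgf my1)) => a b.
  (* the gradient of [f] is only known to be Lipschitz on the domain *)
  have := normr_coord_le (grad f (y k a.1) - grad f (y k b.1)) j.
  rewrite mxE [X in _ + X]mxE => /le_trans; apply.
  rewrite /= -scalerBr enormZ ger0_norm ?(Lgf_ge0 HB)//.
  by apply: lip; [have [] := iterates_edom a.1 k1|have [] := iterates_edom b.1 k1].
have md : row_measurable (fun ws : history k * Xi =>
    gradf ftilde (y k ws.1) ws.2 - grad f (y k ws.1)).
  have mo := measurable_oracle my1
    (measurable_snd : measurable_fun setT (snd : history k * Xi -> Xi)).
  exact: (row_measurableB mo mgf).
apply: measurable_funB; apply: measurable_funM => //.
  under eq_fun do rewrite sqr_enorm.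
  exact: measurable_edot.
apply: measurable_edot => //; apply: row_measurableB => //.
  exact: (row_measurable_comp mfst mz).
Qed.

(** The noise term is bounded because the domain and the gradients are; freezing
    the history reduces its mean to [mean_noise_le]. *)
Lemma mean_path_noise k : (1 <= k)%N ->
  P.-integrable setT (EFin \o path_noise k) /\
  (\int[P]_w (path_noise k w)%:E <= (sigma ^+ 2 / (2 * L k))%:E)%E.
Proof.
move=> k1.
have L0 := L_gt0 (Lgf_ge0 HB) Lgc2_gt0 rhoE k1.
have i0 : 0 <= (2 * (Lgf + rho k * Lgc2))^-1.
  by rewrite invr_ge0 mulr_ge0// ltW.
have /andP[b0 _] := beta01 betaE k1.
pose M := (2 * (Lgf + rho k * Lgc2))^-1 * (2 * G) ^+ 2
  + (beta k)^-1 * (2 * G * DX).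
have bnd ws : `|frozen_noise (k := k) ws| <= M.
  have [_ yX zX] := iterates_edom ws.1 k1.
  have dG := enorm_noise csp HB ws.2 yX.
  apply: (le_trans (ler_normB _ _)); apply: lerD.
    rewrite ger0_norm; last by rewrite mulr_ge0 ?sqr_ge0.
    rewrite ler_wpM2l// ler_sqr ?nnegrE ?enorm_ge0//.
    exact: le_trans (enorm_ge0 _) dG.
  rewrite normrM ger0_norm// ler_wpM2l//.
  apply: (le_trans (normr_edot_le _ _)).
  by rewrite ler_pM ?enorm_ge0//; exact: (A_diameter HA).
have mfn := measurable_frozen_noise k1.
split.
  apply: (@bounded_integrable _ _ _ P _ M); last first.
    by move=> w; exact: (bnd (w, samples k w)).
  apply: (measurableT_comp mfn
    (g := fun w => (to_history samples k w, samples k w))).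
  exact: measurable_fun_pair.
rewrite mulrC.
apply: (integral_fresh_sample iid k1 mfn bnd) => w.
have [_ yX _] := iterates_edom w k1.
exact: (mean_noise_le csp HB (z k w - u) (beta k)^-1 yX i0).
Qed.

Local Notation weight := (step_weight Lgf Lgc2 rho).

Definition potential_cap j w := (weight j)^-1 *
  (25 * DX ^+ 2 + 10 * Lambda ^+ 2 / Lgc2
   + \sum_(1 <= k < j.+1) weight k * path_noise k w).

Lemma potential_le_cap j w : (1 <= j)%N ->
  gap xi ftilde psi Fstar (x j.+1 w)
  + rho j * (violation c (x j.+1 w) ^+ 2 / 2) <= potential_cap j w.
Proof.
move=> j1; apply: (weighted_bound (Lgf_ge0 HB) Lgc2_gt0 rhoE j1).
exact: (stochastic_potential csp HA Lgc2_gt0 HB rhoE betaE gammaE (run w) fu uX uF).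
Qed.

Lemma mean_potential_cap j : (1 <= j)%N ->
  P.-integrable setT (EFin \o potential_cap j) /\
  (\int[P]_w (potential_cap j w)%:E <= ((weight j)^-1 *
    (25 * DX ^+ 2 + 10 * Lambda ^+ 2 / Lgc2
     + sigma ^+ 2 / (2 * Lgc2 ^+ 2) * ln j.+1%:R))%:E)%E.
Proof.
move=> j1; set C1 := 25 * DX ^+ 2 + 10 * Lambda ^+ 2 / Lgc2.
have w0 k : (1 <= k)%N -> 0 <= weight k.
  exact: (step_weight_ge0 (Lgf_ge0 HB) Lgc2_gt0 rhoE).
have iN k : P.-integrable setT
    (fun w => ((weight k.+1)%:E * (path_noise k.+1 w)%:E)%E).
  by apply: integrableZl => //; exact: (mean_path_noise (isT : (1 <= k.+1)%N)).1.
pose S w := (\sum_(0 <= k < j) (weight k.+1)%:E * (path_noise k.+1 w)%:E)%E.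
have iS : P.-integrable setT S by apply: integrable_sum => // k _; exact: iN.
have iC : P.-integrable setT (EFin \o cst C1).
  exact: finite_measure_integrable_cst.
have capE w : (potential_cap j w)%:E = ((weight j)^-1%:E * (C1%:E + S w))%E.
  rewrite /potential_cap big_add1 /= /S.
  under [X in (_ * (_ + X))%E]eq_bigr do rewrite -EFinM.
  by rewrite sumEFin -EFinD -EFinM.
have iCS : P.-integrable setT (fun w => (C1%:E + S w)%E) by exact: integrableD.
split.
  apply: (eq_integrable measurableT (fun w => (weight j)^-1%:E * (C1%:E + S w))%E).
    by move=> w _; rewrite /= capE.
  exact: integrableZl.
under eq_integral do rewrite capE.
rewrite integralZl// integralD// integral_probability_cst.
rewrite EFinM lee_wpmul2l ?lee_fin ?invr_ge0 ?w0//.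
rewrite [X in (_ <= X)%E]EFinD; apply: leeD2l.
rewrite /S integral_sum//.
apply: (@le_trans _ _ (\sum_(0 <= k < j)
   (weight k.+1 * (sigma ^+ 2 / (2 * L k.+1)))%:E)%E).
  apply: lee_sum => k _; rewrite integralZl//; last first.
    exact: (mean_path_noise (isT : (1 <= k.+1)%N)).1.
  rewrite [X in (_ <= X)%E]EFinM lee_wpmul2l ?lee_fin ?w0//.
  exact: (mean_path_noise (isT : (1 <= k.+1)%N)).2.
rewrite sumEFin lee_fin.
have := sum_variance (Lgf_ge0 HB) Lgc2_gt0 rhoE j (sqr_ge0 sigma).
by rewrite big_add1.
Qed.

End iterates.

(** * The rates of the algorithm *)

Theorem theorem2 (R : realType) (n m : nat)
    (d : measure_display) (Omega : measurableType d) (P : probability Omega R)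
    (d' : measure_display) (Xi : measurableType d') (xi : {RV P >-> Xi})
    (ftilde : 'rV[R]_n -> Xi -> R) (psi : 'rV[R]_n -> \bar R)
    (c : 'rV[R]_n -> 'rV[R]_m)
    (Fstar DX DF : R) (Lc Lgc Cb : 'I_m -> R) (Lambda Lgf sigma G : R)
    (beta gamma rho : nat -> R)
    (x1 : 'rV[R]_n) (samples : nat -> {RV P >-> Xi})
    (x y z : nat -> Omega -> 'rV[R]_n) :
  let Lgc2 := \sum_(i < m) (Lc i ^+ 2 + Cb i * Lgc i) in
  let C1 := 25 * DX ^+ 2 + 10 * Lambda ^+ 2 / Lgc2 in
  let C2 := 20 * G * DX * Lgf / (Num.sqrt 6 * Lgc2) + 120 * G * DX in
  convex_stochastic_problem xi ftilde psi c ->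
  is_optimal_value xi ftilde psi c Fstar ->
  assumptionA xi ftilde psi c Fstar DX DF Lc Lgc Cb Lambda ->
  0 < Lgc2 ->
  assumptionB xi ftilde psi Lgf sigma G ->
  (forall k, (1 <= k)%N -> rho k = (k%:R + 4) `^ (3 / 2)) ->
  (forall k, (1 <= k)%N -> beta k = (k%:R + 4) / 5) ->
  (forall k, (1 <= k)%N ->
     gamma k = (k%:R + 4) / (10 * (Lgf + rho k * Lgc2))) ->
  iid_copies [set k | (1 <= k)%N] xi samples ->
  (forall w, algorithm_run ftilde psi c beta gamma rho x1
               (fun k => samples k w)
               (fun k => x k w) (fun k => y k w) (fun k => z k w)) ->
  forall k, (2 <= k)%N ->
  [/\ forall w,
        enorm (pospart (c (x k w))) <=
          Num.sqrt (2 * C2) * k%:R `^ (- (3 / 4))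
          + 2 * Num.sqrt (C1 * Lgc2) * k%:R^-1
          + 2 * Lambda * k%:R `^ (- (3 / 2))
          + 2 * Num.sqrt (C1 * Lgf) * k%:R `^ (- (7 / 4)),
      (\int[P]_w (objective xi ftilde psi (x k w) - Fstar%:E) <=
         (3 * Num.sqrt 3 * sigma ^+ 2 * Lgc2^-1 * k%:R `^ (- (1 / 2)) * ln k%:R
          + 2 * Num.sqrt 3 * C1 * Lgc2 * k%:R `^ (- (1 / 2))
          + 3 * sigma ^+ 2 * Lgf * Lgc2 ^- 2 * k%:R ^- 2 * ln k%:R
          + 2 * C1 * Lgf * k%:R ^- 2)%R%:E)%E &
      ((- (Lambda *
          (Num.sqrt 6 * sigma * (Num.sqrt Lgc2)^-1 * k%:R^-1
             * Num.sqrt (ln k%:R)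
           + 2 * Num.sqrt (C1 * Lgc2) * k%:R^-1
           + 2 * Lambda * k%:R `^ (- (3 / 2))
           + sigma * Lgc2^-1 * Num.sqrt (6 * Lgf) * k%:R `^ (- (7 / 4))
             * Num.sqrt (ln k%:R)
           + 2 * Num.sqrt (C1 * Lgf) * k%:R `^ (- (7 / 4)))))%R%:E
       <= \int[P]_w (objective xi ftilde psi (x k w) - Fstar%:E))%E].
Proof.
move=> Lgc2 C1 C2 csp opt HA Lgc2_gt0 HB rhoE betaE gammaE iid run [//|[//|k _]].
set k2 := k.+2; have k1 : (1 <= k.+1)%N by [].
have [u [fu uX uF]] := optimal_point csp opt.
have Lf0 := Lgf_ge0 HB; have Lam0 := Lambda_ge0 HA.
have DX0 := A_DX_gt0 HA; have G0 := B_G_gt0 HB; have s0 := B_sigma_gt0 HB.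
have xX w : edom psi (x k2 w).
  by have [] := iterates_edom csp Lgc2_gt0 HB rhoE betaE gammaE run uX w
    (isT : (1 <= k2)%N).
have low w := gap_ge csp HA (xX w).
have objE w : (objective xi ftilde psi (x k2 w) - Fstar%:E)%E
    = (gap xi ftilde psi Fstar (x k2 w))%:E.
  by rewrite (objectiveE csp (xX w)) -EFinB.
have cap w := potential_le_cap csp HA Lgc2_gt0 HB rhoE betaE gammaE run fu uX uF
  w k1.
have [icap mcap] := mean_potential_cap csp HA Lgc2_gt0 HB rhoE betaE gammaE iid
  run uX k1.
have -> : (\int[P]_w (objective xi ftilde psi (x k2 w) - Fstar%:E)
    = \int[P]_w (gap xi ftilde psi Fstar (x k2 w))%:E)%E.
  by apply: eq_integral => w _; exact: objE.
split.
- move=> w.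
  apply: (violation_rate Lf0 Lgc2_gt0 Lam0 DX0 rhoE G0 (isT : (2 <= k2)%N)
    (enorm_ge0 _) (low w)).
  exact: (deterministic_potential csp HA Lgc2_gt0 HB rhoE betaE gammaE (run w)
    fu uX uF k1).
- have up := mean_upper_rate Lambda Lf0 Lgc2_gt0 DX0 rhoE s0 (isT : (2 <= k2)%N).
  rewrite -lee_fin in up; apply: le_trans up; apply: le_trans mcap.
  apply: le_integral_pointwise => w; rewrite lee_fin; apply: le_trans (cap w).
  rewrite lerDl mulr_ge0 ?divr_ge0 ?sqr_ge0//.
  by rewrite ltW// (rho_gt0 rhoE).
- have := mean_lower_rate Lf0 Lgc2_gt0 Lam0 DX0 rhoE s0 (isT : (2 <= k2)%N).
  move=> [r [r0 rrho]]; rewrite -/Lgc2 -/C1.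
  set tau := (X in Lambda < r * X); rewrite -/tau => rtau Mtau.
  rewrite -/tau.
  have B0 : 0 < r * tau - Lambda by rewrite subr_gt0.
  pose a := Lambda / (r * tau - Lambda).
  have a0 : 0 <= a by rewrite divr_ge0// ltW.
  have aB : a * (r * tau - Lambda) = Lambda by rewrite divfK// gt_eqF.
  have affine w : - (a * (r * tau ^+ 2 / 2)) - a * potential_cap xi ftilde DX Lc
      Lgc Cb Lambda Lgf beta rho samples y z u k.+1 w
      <= gap xi ftilde psi Fstar (x k2 w).
    have := ler_wpM2l a0 (tangent_bound tau (ltW r0) rrho (low w) (cap w)).
    rewrite mulrCA aB; move: (low w).
    move: (potential_cap _ _ _ _ _ _ _ _ _ _ _ _ _ _ _ _) => W.
    lra.
  apply: (@le_trans _ _ (\int[P]_w (- (a * (r * tau ^+ 2 / 2))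
    - a * potential_cap xi ftilde DX Lc Lgc Cb Lambda Lgf beta rho samples y z u
      k.+1 w)%:E)%E); last first.
    by apply: le_integral_pointwise => w; rewrite lee_fin.
  apply: le_trans (integral_affine_ge _ a0 icap mcap); rewrite lee_fin.
  have := ler_wpM2l a0 Mtau.
  move: aB; rewrite mulrBr; move: (_^-1 * _) => M aB h.
  have : tau * (a * (r * tau) - a * Lambda) = tau * Lambda by rewrite aB.
  lra.
Qed.
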